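(* For every constant $M>0$ there exists a map $u:\mathbb{R}^2\to\mathbb{S}^2$ with $\nabla u\in L^2$ and $\deg(u)=2$ such that for every $(p,q)\in\mathcal A_2$, $$\int_{\mathbb{R}^2}|\nabla(u-\mathcal S(p/q))|^2> M\big(\mathcal E(u)-8\pi\big).$$
   Context: Identify $\mathbb{R}^2$ with $\mathbb{C}$, $z=x+iy$. The stereographic projection $\mathcal S:\mathbb{C}\cup\{\infty\}\to\mathbb{S}^2$ is $\mathcal S(z)=\frac{1}{1+|z|^2}\big(2\,\mathrm{Re}\,z,\,2\,\mathrm{Im}\,z,\,|z|^2-1\big)$, $\mathcal S(\infty)=(0,0,1)$. For $u:\mathbb{R}^2\to\mathbb{S}^2\subset\mathbb{R}^3$, $\mathcal E(u)=\frac12\int_{\mathbb{R}^2}|\nabla u|^2$, and $\deg(u)=\frac{1}{4\pi}\int_{\mathbb{R}^2}u\cdot(u_y\times u_x)$ is its topological degree. $\mathcal A_2$ is the set of pairs $(p,q)$ of complex polynomials in $z$ such that $p/q$ is irreducible and $\max\{\deg p,\deg q\}=2$; the maps $\mathcal S(p/q)$, $(p,q)\in\mathcal A_2$, are exactly the finite-energy degree 2 harmonic maps $\mathbb{R}^2\to\mathbb{S}^2$, and have energy $8\pi$. *)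

(* Defs.v *)
From HB Require Import structures.
From mathcomp Require Import all_boot all_order all_algebra.
From mathcomp Require Import all_classical all_reals all_analysis.
From mathcomp Require Import complex.
Set Implicit Arguments.
Unset Strict Implicit.
Unset Printing Implicit Defensive.
Import Order.TTheory GRing.Theory Num.Theory.
Import numFieldNormedType.Exports.
Local Open Scope ring_scope.

Definition leb2 (R : realType) := ((@lebesgue_measure R) \x (@lebesgue_measure R))%E.
Arguments leb2 R : clear implicits.

Definition dx (R : realType) (f : R * R -> 'rV[R]_3) (z : R * R) : 'rV[R]_3 :=
  'D_((1, 0) : R * R) f z.
Definition dy (R : realType) (f : R * R -> 'rV[R]_3) (z : R * R) : 'rV[R]_3 :=
  'D_((0, 1) : R * R) f z.

Definition c3 (R : realType) (v : 'rV[R]_3) (k : nat) : R := v ord0 (inord k).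

Definition gradsq (R : realType) (f : R * R -> 'rV[R]_3) (z : R * R) : R :=
  \sum_(i < 3) ((dx f z ord0 i) ^+ 2 + (dy f z ord0 i) ^+ 2).

Definition triple (R : realType) (a b c : 'rV[R]_3) : R :=
  c3 a 0 * (c3 b 1 * c3 c 2 - c3 b 2 * c3 c 1)
  + c3 a 1 * (c3 b 2 * c3 c 0 - c3 b 0 * c3 c 2)
  + c3 a 2 * (c3 b 0 * c3 c 1 - c3 b 1 * c3 c 0).

Definition sphere_valued (R : realType) (u : R * R -> 'rV[R]_3) : Prop :=
  forall z, \sum_(i < 3) (u z ord0 i) ^+ 2 = 1.

Definition finite_dirichlet (R : realType) (u : R * R -> 'rV[R]_3) : Prop :=
  (\int[leb2 R]_z (gradsq u z)%:E < +oo)%E.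

Definition energy (R : realType) (u : R * R -> 'rV[R]_3) : R :=
  2^-1 * Rintegral (leb2 R) setT (gradsq u).

Definition degree (R : realType) (u : R * R -> 'rV[R]_3) : R :=
  (4 * pi)^-1 * Rintegral (leb2 R) setT (fun z => triple (u z) (dy u z) (dx u z)).

Definition normsqC (R : realType) (w : R[i]) : R := complex.Re w ^+ 2 + complex.Im w ^+ 2.

Definition stereo (R : realType) (w : R[i]) : 'rV[R]_3 :=
  (1 + normsqC w)^-1 *: \row_(i < 3) [:: 2 * complex.Re w; 2 * complex.Im w; normsqC w - 1]`_i.

Definition north_pole (R : realType) : 'rV[R]_3 := \row_(i < 3) [:: 0; 0; 1]`_i.
Arguments north_pole R : clear implicits.

(* The map S(p/q) : R^2 -> S^2 (poles of p/q are sent to S(infinity)). *)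
Definition stereo_rat (R : realType) (p q : {poly R[i]}) (z : R * R) : 'rV[R]_3 :=
  let w := Complex z.1 z.2 in
  if q.[w] == 0 then north_pole R else stereo (p.[w] / q.[w]).

Definition A2 (R : realType) (p q : {poly R[i]}) : Prop :=
  coprimep p q /\ maxn (size p) (size q) = 3%N.

(* Main.v *)
Require Import Defs.
From HB Require Import structures.
From mathcomp Require Import all_boot all_order all_algebra.
From mathcomp Require Import all_classical all_reals all_analysis.
From mathcomp Require Import measurable_realfun complex zify ring lra.
Set Implicit Arguments.
Unset Strict Implicit.
Unset Printing Implicit Defensive.
Import Order.TTheory GRing.Theory Num.Theory.
Import numFieldNormedType.Exports.
Local Open Scope ring_scope.

(** Glue two bubbles of very different scales whose positions do not match: with
   d = exp(-L), let u be the stereographic image of (z^2 + phi z + d) / z, that is of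
   z + phi + d/z, where the radial cutoff phi is 1 for |z|^2 + d^2 <= d, 0 for
   |z|^2 + d^2 >= 1, and a function of ln(|z|^2 + d^2) / L in between. The energy
   excess over 4 pi deg(u) is the integral of 2 |grad phi|^2 |z|^4 / (|p|^2 + |q|^2)^2,
   which is O(1/L), and Green's formula on large squares gives degree 2.

   If grad (u - S(p/q)) were small in L^2, it would be small at four well separated
   points near |z| = 1 and at four near |z| = d. Both maps being conformal there, u is
   then close to S(p/q) at these points, and interpolation of cubic polynomials shows
   that the coefficients of p and q nearly satisfy p = z q at scale 1 and
   z p = (z + d) q at scale d, which is impossible for quadratic p and q. *)

(** * Differentiable functions on the plane *)

(** The obstruction sits in the neck: seen from outside the map is close to z, with value 0 at the
    concentration point; seen from inside it is 1 + d/z, with value 1 at infinity. A quadratic p/q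
    has a single neck value p1/q1, the quotient of the coefficients of z. Passing from 0 to 1 costs
    only the logarithmic capacity of the annulus, of order 1/L, whereas the distance to rational
    maps stays above an absolute constant e; L is chosen last, beyond a multiple of M/e. Integrals
    are computed by Green's formula alone, without polar coordinates: the lift (p, q) never
    vanishes, so the area form is the curl of a global field, and the excess is bounded by a flux.
    No compactness enters. A conformal map has its value determined by its differential, as a normal
    to the image, so one point with close differentials gives close values, without a constant of
    integration. Each square of side l contains such a point because the Dirichlet integral is scale
    invariant. After cross-multiplication closeness is linear in the coefficients of (p, q), so
    errors are measured against their sum. *)

Section PlaneC1.
Context {R : realType}.
Implicit Types (f g fx fy gx gy : R * R -> R) (z : R * R).

(* Measurability is carried along with continuity because the product
   sigma-algebra on R * R is not known to be the Borel one. *)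
Definition contm f := continuous f /\
  measurable_fun [set: measurableTypeR R * measurableTypeR R] f.

Lemma contm_cst (a : R) : contm (fun=> a).
Proof. by split; [exact: cst_continuous|exact: measurable_cst]. Qed.

Lemma contm_fst : contm fst.
Proof. by split; [move=> z; exact: cvg_fst|exact: measurable_fst]. Qed.

Lemma contm_snd : contm snd.
Proof. by split; [move=> z; exact: cvg_snd|exact: measurable_snd]. Qed.

Lemma contmD f g : contm f -> contm g -> contm (fun z => f z + g z).
Proof.
move=> [cf mf] [cg mg]; split; last exact: measurable_funD.
by move=> z; apply: cvgD; [exact: cf|exact: cg].
Qed.

Lemma contmN f : contm f -> contm (fun z => - f z).
Proof.
move=> [cf mf]; split; last exact: measurable_funN.
by move=> z; apply: cvgN; exact: cf.
Qed.

Lemma contmB f g : contm f -> contm g -> contm (fun z => f z - g z).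
Proof. by move=> cf cg; apply: contmD => //; exact: contmN. Qed.

Lemma contmM f g : contm f -> contm g -> contm (fun z => f z * g z).
Proof.
move=> [cf mf] [cg mg]; split; last exact: measurable_funM.
by move=> z; apply: cvgM; [exact: cf|exact: cg].
Qed.

Lemma contmX f n : contm f -> contm (fun z => f z ^+ n).
Proof.
move=> cf; elim: n => [|n IHn].
  by under eq_fun do rewrite expr0; exact: contm_cst.
by under eq_fun do rewrite exprS; exact: contmM.
Qed.

Lemma contm_comp (h : R -> R) f : continuous h -> contm f -> contm (fun z => h (f z)).
Proof.
move=> ch [cf mf]; split.
  by move=> z; apply: continuous_comp; [exact: cf|exact: ch].
exact: (measurableT_comp (continuous_measurable_fun ch)).
Qed.

Lemma contmV f : (forall z, 0 < f z) -> contm f -> contm (fun z => (f z)^-1).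
Proof.
move=> f0 [cf mf]; split.
  by move=> z; apply: cvgV; [rewrite gt_eqF|exact: cf].
(* On positive values the inverse is exp(- ln f), a composition of measurable functions. *)
have -> : (fun z => (f z)^-1) = expR \o (fun z => - ln (f z)).
  by apply/funext => z /=; rewrite -lnV ?lnK ?posrE ?invr_gt0.
apply: measurableT_comp; first exact: measurable_expR.
by apply: measurable_funN; apply: measurableT_comp.
Qed.

(** The partial derivatives are explicit functions, so that each closure rule computes them and
    [hasgradE] replaces them by simplified forms. Total differentiability is what the chain rule
    uses. *)
Definition hasgrad f fx fy : Prop :=
  [/\ forall z, differentiable f z,
      forall z, 'D_((1, 0) : R * R) f z = fx z,
      forall z, 'D_((0, 1) : R * R) f z = fy z &
      [/\ contm f, contm fx & contm fy]].

Lemma hasgradE f fx fy gx gy : hasgrad f fx fy -> fx =1 gx -> fy =1 gy ->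
  hasgrad f gx gy.
Proof. by move=> + /funext <- /funext <-. Qed.

Lemma hasgrad_cst (a : R) : hasgrad (fun=> a) (fun=> 0) (fun=> 0).
Proof.
split=> [z|z|z|]; [exact: differentiable_cst|exact: derive_cst|exact: derive_cst|].
by split; exact: contm_cst.
Qed.

Lemma hasgrad_fst : hasgrad fst (fun=> 1) (fun=> 0).
Proof.
have df (z : R * R) : differentiable (fst : R * R -> R) z.
  by apply/linear_differentiable => ?; exact: cvg_fst.
have De v z : 'D_v (fst : R * R -> R) z = v.1.
  rewrite deriveE//; rewrite diff_lin//.
  by move=> ?; exact: cvg_fst.
split=> //; split; [exact: contm_fst|exact: contm_cst|exact: contm_cst].
Qed.

Lemma hasgrad_snd : hasgrad snd (fun=> 0) (fun=> 1).
Proof.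
have df (z : R * R) : differentiable (snd : R * R -> R) z.
  by apply/linear_differentiable => ?; exact: cvg_snd.
have De v z : 'D_v (snd : R * R -> R) z = v.2.
  rewrite deriveE//; rewrite diff_lin//.
  by move=> ?; exact: cvg_snd.
split=> //; split; [exact: contm_snd|exact: contm_cst|exact: contm_cst].
Qed.

Lemma hasgradD f fx fy g gx gy : hasgrad f fx fy -> hasgrad g gx gy ->
  hasgrad (fun z => f z + g z) (fun z => fx z + gx z) (fun z => fy z + gy z).
Proof.
move=> [df fX fY [cf cfx cfy]] [dg gX gY [cg cgx cgy]]; split=> [z|z|z|].
- exact: differentiableD.
- by rewrite deriveD ?fX ?gX//; exact: diff_derivable.
- by rewrite deriveD ?fY ?gY//; exact: diff_derivable.
- by split; exact: contmD.
Qed.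

Lemma hasgradN f fx fy : hasgrad f fx fy ->
  hasgrad (fun z => - f z) (fun z => - fx z) (fun z => - fy z).
Proof.
move=> [df fX fY [cf cfx cfy]]; split=> [z|z|z|].
- exact: differentiableN.
- by rewrite deriveN ?fX//; exact: diff_derivable.
- by rewrite deriveN ?fY//; exact: diff_derivable.
- by split; exact: contmN.
Qed.

Lemma hasgradB f fx fy g gx gy : hasgrad f fx fy -> hasgrad g gx gy ->
  hasgrad (fun z => f z - g z) (fun z => fx z - gx z) (fun z => fy z - gy z).
Proof. by move=> hf hg; apply: hasgradD => //; exact: hasgradN. Qed.

Lemma hasgradM f fx fy g gx gy : hasgrad f fx fy -> hasgrad g gx gy ->
  hasgrad (fun z => f z * g z) (fun z => fx z * g z + f z * gx z)
    (fun z => fy z * g z + f z * gy z).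
Proof.
move=> [df fX fY [cf cfx cfy]] [dg gX gY [cg cgx cgy]]; split=> [z|z|z|].
- exact: differentiableM.
- rewrite deriveM ?fX ?gX; [|exact: diff_derivable|exact: diff_derivable].
  by rewrite /GRing.scale/= addrC mulrC.
- rewrite deriveM ?fY ?gY; [|exact: diff_derivable|exact: diff_derivable].
  by rewrite /GRing.scale/= addrC mulrC.
- by split; [exact: contmM| |]; apply: contmD; exact: contmM.
Qed.

Lemma hasgrad_comp (h h' : R -> R) f fx fy : hasgrad f fx fy ->
  (forall z, is_derive (f z) 1 h (h' (f z))) ->
  contm (fun z => h (f z)) -> contm (fun z => h' (f z)) ->
  hasgrad (fun z => h (f z)) (fun z => h' (f z) * fx z) (fun z => h' (f z) * fy z).
Proof.
move=> [df fX fY [cf cfx cfy]] dh ch ch'.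
have dh1 z : differentiable h (f z) by apply/derivable1_diffP; apply: (@ex_derive _ _ _ _ _ _ _ (dh z)).
have dhf z : differentiable (fun z => h (f z)) z by apply: differentiable_comp.
have De v z : 'D_v (fun z => h (f z)) z = h' (f z) * 'D_v f z.
  have hE w : 'd h (f z) w = w * h' (f z).
    by rewrite diff1E// derive1E (@derive_val _ _ _ _ _ _ _ (dh z)).
  rewrite deriveE// (@diff_comp _ _ _ _ f h)//= [in RHS]deriveE// mulrC.
  exact: hE.
split=> // [z|z|]; rewrite ?De ?fX ?fY//.
by split=> //; exact: contmM.
Qed.

Lemma hasgradV f fx fy : (forall z, 0 < f z) -> hasgrad f fx fy ->
  hasgrad (fun z => (f z)^-1) (fun z => - fx z * (f z)^-1 ^+ 2)
    (fun z => - fy z * (f z)^-1 ^+ 2).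
Proof.
move=> f0 [df fX fY [cf cfx cfy]].
have n0 z : f z != 0 by rewrite gt_eqF.
have cV : contm (fun z => (f z)^-1) by exact: contmV.
have De v z : 'D_v (fun z => (f z)^-1) z = - 'D_v f z * (f z)^-1 ^+ 2.
  rewrite deriveV//; last exact: diff_derivable.
  by rewrite /GRing.scale/= exprVn mulNr mulrC -mulNr.
split=> [z|z|z|]; rewrite ?De ?fX ?fY//; first exact: differentiableV.
by split=> //; apply: contmM; [exact: contmN|exact: contmX|exact: contmN|exact: contmX].
Qed.
End PlaneC1.

(** * Green's formula on squares *)

Section GreenSquare.
Local Open Scope classical_set_scope.
Context {R : realType}.
Implicit Types (f g fx fy : R * R -> R) (T : R).

Local Notation mu := (@lebesgue_measure R).
Local Notation mu2 := (mu \x mu)%E.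

Definition sq T : set (measurableTypeR R * measurableTypeR R) := `[- T, T] `*` `[- T, T].

Lemma measurable_sq T : measurable (sq T).
Proof. by apply: measurableX; exact: measurable_itv. Qed.

Lemma rectangle_lty (a b c d : R) :
  (mu2 (`[a, b] `*` `[c, d]) < +oo)%E.
Proof.
rewrite product_measure1E; [|exact: measurable_itv|exact: measurable_itv].
have fin u v : (mu `[u, v] < +oo)%E by exact/compact_finite_measure/segment_compact.
by rewrite lte_mul_pinfty ?ge0_fin_numE//=; exact: fin.
Qed.

Lemma integrable_sq f T : contm f -> mu2.-integrable (sq T) (EFin \o f).
Proof.
move=> [cf mf]; apply: measurable_bounded_integrable.
- exact: measurable_sq.
- exact: rectangle_lty.
- exact: measurable_funS mf.
- have cA : compact (sq T) by apply: compact_setX; exact: segment_compact.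
  have cfT : {within sq T, continuous f} by exact: continuous_subspaceT.
  have /compact_bounded[B [_ mrt]] := continuous_compact cfT cA.
  by exists B; split; rewrite ?num_real // => ? ? ? ?; exact: mrt.
Qed.

Lemma derivable_line1 f fx fy (x y : R) : hasgrad f fx fy ->
  derivable (fun t : R => f (t, y)) x 1 /\ (fun t : R => f (t, y))^`() x = fx (x, y).
Proof.
move=> [df fX _ _].
have E : (fun h : R => h^-1 *: (f (h *: ((1, 0) : R * R) + (x, y)) - f (x, y))) =
         (fun h : R => h^-1 *: (f (h *: 1 + x, y) - f (x, y))).
  apply/funext => h; congr (_ *: (f _ - _)).
  by rewrite [LHS]surjective_pairing/= scaler0 add0r.
split; last by rewrite derive1E -fX /derive E.
have /(_ (1, 0)) := @diff_derivable _ _ _ f (x, y) ^~ (df (x, y)).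
by rewrite /derivable E.
Qed.

Lemma derivable_line2 f fx fy (x y : R) : hasgrad f fx fy ->
  derivable (fun t : R => f (x, t)) y 1 /\ (fun t : R => f (x, t))^`() y = fy (x, y).
Proof.
move=> [df _ fY _].
have E : (fun h : R => h^-1 *: (f (h *: ((0, 1) : R * R) + (x, y)) - f (x, y))) =
         (fun h : R => h^-1 *: (f (x, h *: 1 + y) - f (x, y))).
  apply/funext => h; congr (_ *: (f _ - _)).
  by rewrite [LHS]surjective_pairing/= scaler0 add0r.
split; last by rewrite derive1E -fY /derive E.
have /(_ (0, 1)) := @diff_derivable _ _ _ f (x, y) ^~ (df (x, y)).
by rewrite /derivable E.
Qed.

Lemma continuous_line1 f (y : R) : continuous f -> continuous (fun t : R => f (t, y)).
Proof.
move=> cf t; apply: continuous_comp; last exact: cf.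
exact: (@cvg_pair R R R (nbhs t) (nbhs t) (nbhs y) _ _ _ id (fun=> y) cvg_id (cvg_cst y)).
Qed.

Lemma continuous_line2 f (x : R) : continuous f -> continuous (fun t : R => f (x, t)).
Proof.
move=> cf t; apply: continuous_comp; last exact: cf.
exact: (@cvg_pair R R R (nbhs t) (nbhs x) (nbhs t) _ _ _ (fun=> x) id (cvg_cst x) cvg_id).
Qed.

Lemma ftc_everywhere (F F' : R -> R) (a b : R) : a < b -> continuous F' ->
  (forall x, derivable F x 1 /\ F^`() x = F' x) ->
  (\int[mu]_(x in `[a, b]) (F' x)%:E = (F b - F a)%:E)%E.
Proof.
move=> ab cF' dF; have cF : continuous F.
  by move=> x; apply/differentiable_continuous/derivable1_diffP; case: (dF x).
rewrite EFinB; apply: (continuous_FTC2 ab).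
- exact: continuous_subspaceT.
- split; first by move=> x _; case: (dF x).
  + by apply: cvg_at_right_filter; exact: cF.
  + by apply: cvg_at_left_filter; exact: cF.
- by move=> x _; case: (dF x).
Qed.

(** Fubini, then the fundamental theorem of calculus on each horizontal line. With [green_y] it
    serves twice: for a curl in [btriple_sq] and for a divergence in [defect_sq_le]. *)
Lemma green_x f fx fy T : 0 < T -> hasgrad f fx fy ->
  (\int[mu2]_(z in sq T) (fx z)%:E =
   \int[mu]_(y in `[(- T)%R, T]) (f (T, y) - f (- T, y))%:E)%E.
Proof.
move=> T0 hf; have [_ _ _ [cf cfx _]] := hf.
have mT := measurable_sq T.
have ig := (integrable_mkcond _ mT).1 (integrable_sq T cfx).
(* Both integrands are extended by zero, so that Fubini applies on the whole plane. *)
rewrite integral_mkcond [RHS]integral_mkcond.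
rewrite -(integral21_prod_meas1 ig).
apply: eq_integral => y _; rewrite /fubini_G [RHS]patchE.
case: ifPn => yT; last first.
  rewrite integral0_eq// => x _; rewrite patchE ifF//.
  by apply: contraNF yT; rewrite !inE => -[].
rewrite -(@ftc_everywhere (fun t : R => f (t, y)) (fun t : R => fx (t, y))); last first.
- by move=> x; exact: (derivable_line1 _ _ hf).
- by apply: continuous_line1; case: cfx.
- by rewrite gt0_cp.
rewrite [RHS]integral_mkcond; apply: eq_integral => x _; rewrite !patchE.
congr (if _ then _ else _); apply/idP/idP; rewrite !inE; first by case.
by move=> xT; split=> //; move: yT; rewrite inE.
Qed.

Lemma green_y f fx fy T : 0 < T -> hasgrad f fx fy ->
  (\int[mu2]_(z in sq T) (fy z)%:E =
   \int[mu]_(x in `[(- T)%R, T]) (f (x, T) - f (x, - T))%:E)%E.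
Proof.
move=> T0 hf; have [_ _ _ [cf _ cfy]] := hf.
have mT := measurable_sq T.
have ig := (integrable_mkcond _ mT).1 (integrable_sq T cfy).
rewrite integral_mkcond [RHS]integral_mkcond.
rewrite -(integral12_prod_meas1 ig).
apply: eq_integral => x _; rewrite /fubini_F [RHS]patchE.
case: ifPn => xT; last first.
  rewrite integral0_eq// => y _; rewrite patchE ifF//.
  by apply: contraNF xT; rewrite !inE => -[].
rewrite -(@ftc_everywhere (fun t : R => f (x, t)) (fun t : R => fy (x, t))); last first.
- by move=> y; exact: (derivable_line2 _ _ hf).
- by apply: continuous_line2; case: cfy.
- by rewrite gt0_cp.
rewrite [RHS]integral_mkcond; apply: eq_integral => y _; rewrite !patchE.
congr (if _ then _ else _); apply/idP/idP; rewrite !inE; first by case.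
by move=> yT; split=> //; move: xT; rewrite inE.
Qed.

End GreenSquare.

(** * Conformal maps into the sphere *)

Section ConformalPair.
Context {R : realFieldType}.

(* For unit vectors u, v and tangent vectors x, y, the hypotheses say that the
   frames (x, u ^ x) and (y, v ^ y), with ^ the cross product, are the differentials
   of two conformal maps: then the maps are as close as their differentials. *)
Lemma conformal_gap (u1 u2 u3 v1 v2 v3 x1 x2 x3 y1 y2 y3 : R) :
  u1 ^+ 2 + u2 ^+ 2 + u3 ^+ 2 = 1 -> v1 ^+ 2 + v2 ^+ 2 + v3 ^+ 2 = 1 ->
  u1 * x1 + u2 * x2 + u3 * x3 = 0 -> v1 * y1 + v2 * y2 + v3 * y3 = 0 ->
  ((u1 - v1) ^+ 2 + (u2 - v2) ^+ 2 + (u3 - v3) ^+ 2) * (x1 ^+ 2 + x2 ^+ 2 + x3 ^+ 2) <=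
  4 * ((x1 - y1) ^+ 2 + (x2 - y2) ^+ 2 + (x3 - y3) ^+ 2 +
    ((u2 * x3 - u3 * x2) - (v2 * y3 - v3 * y2)) ^+ 2 +
    ((u3 * x1 - u1 * x3) - (v3 * y1 - v1 * y3)) ^+ 2 +
    ((u1 * x2 - u2 * x1) - (v1 * y2 - v2 * y1)) ^+ 2).
Proof.
move=> Hu Hv Hux Hvy.
(* w = u ^ x and s = v ^ y complete the two frames; below, e = u - v. *)
set w1 := u2 * x3 - u3 * x2; set w2 := u3 * x1 - u1 * x3; set w3 := u1 * x2 - u2 * x1.
set s1 := v2 * y3 - v3 * y2; set s2 := v3 * y1 - v1 * y3; set s3 := v1 * y2 - v2 * y1.
have cross_le (a1 a2 a3 b1 b2 b3 : R) : a1 ^+ 2 + a2 ^+ 2 + a3 ^+ 2 = 1 ->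
  (a2 * b3 - a3 * b2) ^+ 2 + (a3 * b1 - a1 * b3) ^+ 2 + (a1 * b2 - a2 * b1) ^+ 2 <=
  b1 ^+ 2 + b2 ^+ 2 + b3 ^+ 2.
  move=> Ha; rewrite -subr_ge0.
  have -> : b1 ^+ 2 + b2 ^+ 2 + b3 ^+ 2 - ((a2 * b3 - a3 * b2) ^+ 2 +
      (a3 * b1 - a1 * b3) ^+ 2 + (a1 * b2 - a2 * b1) ^+ 2) =
    (1 - (a1 ^+ 2 + a2 ^+ 2 + a3 ^+ 2)) * (b1 ^+ 2 + b2 ^+ 2 + b3 ^+ 2) +
    (a1 * b1 + a2 * b2 + a3 * b3) ^+ 2 by ring.
  by rewrite Ha subrr mul0r add0r sqr_ge0.
have sqrB_le (a b : R) : (a - b) ^+ 2 <= 2 * a ^+ 2 + 2 * b ^+ 2.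
  by have := sqr_ge0 (a + b); lra.
set d := (x1 - y1) ^+ 2 + (x2 - y2) ^+ 2 + (x3 - y3) ^+ 2.
set d' := (w1 - s1) ^+ 2 + (w2 - s2) ^+ 2 + (w3 - s3) ^+ 2.
set e1 := u1 - v1; set e2 := u2 - v2; set e3 := u3 - v3.
(* e ^ x = (w - s) - v ^ (x - y), and v ^ does not increase lengths. *)
have Hx : (e2 * x3 - e3 * x2) ^+ 2 + (e3 * x1 - e1 * x3) ^+ 2 +
    (e1 * x2 - e2 * x1) ^+ 2 <= 2 * d' + 2 * d.
  have := cross_le v1 v2 v3 (x1 - y1) (x2 - y2) (x3 - y3) Hv; rewrite -/d => C.
  have := sqrB_le (w1 - s1) (v2 * (x3 - y3) - v3 * (x2 - y2)).
  have := sqrB_le (w2 - s2) (v3 * (x1 - y1) - v1 * (x3 - y3)).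
  have := sqrB_le (w3 - s3) (v1 * (x2 - y2) - v2 * (x1 - y1)).
  have -> : w1 - s1 - (v2 * (x3 - y3) - v3 * (x2 - y2)) = e2 * x3 - e3 * x2
    by rewrite /w1 /s1 /e2 /e3; ring.
  have -> : w2 - s2 - (v3 * (x1 - y1) - v1 * (x3 - y3)) = e3 * x1 - e1 * x3
    by rewrite /w2 /s2 /e3 /e1; ring.
  have -> : w3 - s3 - (v1 * (x2 - y2) - v2 * (x1 - y1)) = e1 * x2 - e2 * x1
    by rewrite /w3 /s3 /e1 /e2; ring.
  by rewrite /d'; lra.
(* a ^ (a ^ b) = - b for a unit vector a orthogonal to b. *)
have bac (a1 a2 a3 b1 b2 b3 : R) : a1 ^+ 2 + a2 ^+ 2 + a3 ^+ 2 = 1 ->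
  a1 * b1 + a2 * b2 + a3 * b3 = 0 ->
  [/\ a2 * (a1 * b2 - a2 * b1) - a3 * (a3 * b1 - a1 * b3) = - b1,
      a3 * (a2 * b3 - a3 * b2) - a1 * (a1 * b2 - a2 * b1) = - b2 &
      a1 * (a3 * b1 - a1 * b3) - a2 * (a2 * b3 - a3 * b2) = - b3].
  move=> Ha Hab; split.
  - transitivity (a1 * (a1 * b1 + a2 * b2 + a3 * b3) - (a1 ^+ 2 + a2 ^+ 2 + a3 ^+ 2) * b1).
      by ring.
    by rewrite Ha Hab; ring.
  - transitivity (a2 * (a1 * b1 + a2 * b2 + a3 * b3) - (a1 ^+ 2 + a2 ^+ 2 + a3 ^+ 2) * b2).
      by ring.
    by rewrite Ha Hab; ring.
  - transitivity (a3 * (a1 * b1 + a2 * b2 + a3 * b3) - (a1 ^+ 2 + a2 ^+ 2 + a3 ^+ 2) * b3).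
      by ring.
    by rewrite Ha Hab; ring.
(* e ^ w = (y - x) - v ^ (w - s), since u ^ w = - x and v ^ s = - y. *)
have Hw : (e2 * w3 - e3 * w2) ^+ 2 + (e3 * w1 - e1 * w3) ^+ 2 +
    (e1 * w2 - e2 * w1) ^+ 2 <= 2 * d' + 2 * d.
  have := cross_le v1 v2 v3 (w1 - s1) (w2 - s2) (w3 - s3) Hv; rewrite -/d' => C.
  have [U1 U2 U3] := bac _ _ _ _ _ _ Hu Hux.
  have [V1 V2 V3] := bac _ _ _ _ _ _ Hv Hvy.
  have := sqrB_le (y1 - x1) (v2 * (w3 - s3) - v3 * (w2 - s2)).
  have := sqrB_le (y2 - x2) (v3 * (w1 - s1) - v1 * (w3 - s3)).
  have := sqrB_le (y3 - x3) (v1 * (w2 - s2) - v2 * (w1 - s1)).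
  have -> : y1 - x1 - (v2 * (w3 - s3) - v3 * (w2 - s2)) = e2 * w3 - e3 * w2.
    by move: U1 V1; rewrite -/w2 -/w3 -/s2 -/s3 /e2 /e3 => U1 V1; lra.
  have -> : y2 - x2 - (v3 * (w1 - s1) - v1 * (w3 - s3)) = e3 * w1 - e1 * w3.
    by move: U2 V2; rewrite -/w1 -/w3 -/s1 -/s3 /e1 /e3 => U2 V2; lra.
  have -> : y3 - x3 - (v1 * (w2 - s2) - v2 * (w1 - s1)) = e1 * w2 - e2 * w1.
    by move: U3 V3; rewrite -/w1 -/w2 -/s1 -/s2 /e1 /e2 => U3 V3; lra.
  by rewrite /d; lra.
have Hxw : x1 * w1 + x2 * w2 + x3 * w3 = 0 by rewrite /w1 /w2 /w3; ring.
have Hww : w1 ^+ 2 + w2 ^+ 2 + w3 ^+ 2 = x1 ^+ 2 + x2 ^+ 2 + x3 ^+ 2.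
  transitivity ((u1 ^+ 2 + u2 ^+ 2 + u3 ^+ 2) * (x1 ^+ 2 + x2 ^+ 2 + x3 ^+ 2) -
    (u1 * x1 + u2 * x2 + u3 * x3) ^+ 2); first by rewrite /w1 /w2 /w3; ring.
  by rewrite Hu Hux; ring.
(* Lagrange's identity makes [Hx] and [Hw] bounds on |e|^2 |x|^2 minus the squared dot products of e
   with x and with w. As x and w are orthogonal of equal length, Bessel's inequality absorbs one
   copy of |e|^2 |x|^2 out of two. *)
have Lag (a1 a2 a3 b1 b2 b3 : R) :
  (a2 * b3 - a3 * b2) ^+ 2 + (a3 * b1 - a1 * b3) ^+ 2 + (a1 * b2 - a2 * b1) ^+ 2 =
  (a1 ^+ 2 + a2 ^+ 2 + a3 ^+ 2) * (b1 ^+ 2 + b2 ^+ 2 + b3 ^+ 2) -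
  (a1 * b1 + a2 * b2 + a3 * b3) ^+ 2 by ring.
rewrite Lag in Hx; rewrite Lag Hww in Hw.
set ex := e1 * x1 + e2 * x2 + e3 * x3 in Hx.
set ew := e1 * w1 + e2 * w2 + e3 * w3 in Hw.
set X := x1 ^+ 2 + x2 ^+ 2 + x3 ^+ 2 in Hx Hw Hww *.
set S := e1 ^+ 2 + e2 ^+ 2 + e3 ^+ 2 in Hx Hw *.
have X0 : 0 <= X by rewrite !addr_ge0// sqr_ge0.
have Bessel : ex ^+ 2 + ew ^+ 2 <= S * X.
  have [X00|Xn0] := eqVneq X 0.
    have xi0 (a b c : R) : a ^+ 2 + b ^+ 2 + c ^+ 2 = 0 -> a = 0 /\ b = 0 /\ c = 0.
      move=> /eqP; rewrite !paddr_eq0 ?addr_ge0 ?sqr_ge0// !sqrf_eq0.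
      by move=> /andP[/andP[/eqP-> /eqP->] /eqP->].
    have [a0 [b0 c0]] := xi0 _ _ _ X00.
    have [a0' [b0' c0']] := xi0 _ _ _ (etrans Hww X00).
    by rewrite X00 /ex /ew a0 b0 c0 a0' b0' c0' !mulr0 !addr0 expr0n addr0.
  rewrite -(ler_pM2r (x := X)) ?lt0r ?Xn0// -subr_ge0.
  suff -> : S * X * X - (ex ^+ 2 + ew ^+ 2) * X =
     (X * e1 - ex * x1 - ew * w1) ^+ 2 + (X * e2 - ex * x2 - ew * w2) ^+ 2 +
     (X * e3 - ex * x3 - ew * w3) ^+ 2 by rewrite !addr_ge0// sqr_ge0.
  transitivity (X ^+ 2 * S - 2 * X * (ex ^+ 2 + ew ^+ 2) + ex ^+ 2 * X
    + ew ^+ 2 * X); first by ring.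
  rewrite -{2}Hww {2}/X.
  transitivity (X ^+ 2 * S - 2 * X * (ex * (e1 * x1 + e2 * x2 + e3 * x3) +
     ew * (e1 * w1 + e2 * w2 + e3 * w3)) + ex ^+ 2 * (x1 ^+ 2 + x2 ^+ 2 + x3 ^+ 2)
    + ew ^+ 2 * (w1 ^+ 2 + w2 ^+ 2 + w3 ^+ 2) +
    2 * ex * ew * (x1 * w1 + x2 * w2 + x3 * w3)).
    by rewrite Hxw Hww -/ex -/ew -/X; ring.
  by rewrite /S; ring.
have -> : d + (w1 - s1) ^+ 2 + (w2 - s2) ^+ 2 + (w3 - s3) ^+ 2 = d + d'.
  by rewrite /d'; ring.
by lra.
Qed.

End ConformalPair.

(** * The Hopf map in homogeneous coordinates *)

Section HopfAlgebra.
Context {R : realType}.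
Implicit Types A B C D a b k : R.

Definition row3 (x y z : R) : 'rV[R]_3 := \row_(i < 3) [:: x; y; z]`_i.

Lemma row3E0 x y z : row3 x y z ord0 (inord 0) = x.
Proof. by rewrite mxE inordK. Qed.
Lemma row3E1 x y z : row3 x y z ord0 (inord 1) = y.
Proof. by rewrite mxE inordK. Qed.
Lemma row3E2 x y z : row3 x y z ord0 (inord 2) = z.
Proof. by rewrite mxE inordK. Qed.

Lemma rowZE k (v : 'rV[R]_3) i : (k *: v) ord0 i = k * v ord0 i.
Proof. by rewrite mxE. Qed.

Definition row3E := (row3E0, row3E1, row3E2).

Lemma sum3E (F : 'I_3 -> R) : \sum_(i < 3) F i = F (inord 0) + F (inord 1) + F (inord 2).
Proof.
rewrite !big_ord_recl big_ord0 addr0 addrA.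
by congr (F _ + F _ + F _); apply/val_inj; rewrite /= inordK.
Qed.

(* With p = A + iB and q = C + iD, [hopf] is the stereographic image of p/q in
   homogeneous coordinates; if moreover w = a + ib is the value of p' q - p q'
   for a directional derivative ', then [hopfD] is that derivative of [hopf]. *)
Definition spin A B C D : R := A ^+ 2 + B ^+ 2 + C ^+ 2 + D ^+ 2.

Definition hopf A B C D : 'rV[R]_3 := (spin A B C D)^-1 *:
  row3 (2 * (A * C + B * D)) (2 * (B * C - A * D))
    (A ^+ 2 + B ^+ 2 - C ^+ 2 - D ^+ 2).

Definition hopfD A B C D a b : 'rV[R]_3 := (2 * (spin A B C D)^-1 ^+ 2) *: row3
  (a * (C ^+ 2 - D ^+ 2 - A ^+ 2 + B ^+ 2) + b * (2 * C * D - 2 * A * B))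
  (b * (C ^+ 2 - D ^+ 2 + A ^+ 2 - B ^+ 2) - a * (2 * C * D + 2 * A * B))
  (a * (2 * (A * C - B * D)) + b * (2 * (A * D + B * C))).

Lemma hopf_unit A B C D : 0 < spin A B C D ->
  \sum_(i < 3) (hopf A B C D ord0 i) ^+ 2 = 1.
Proof.
move=> s0; rewrite sum3E /hopf !rowZE !row3E.
set s := spin _ _ _ _ in s0 *.
set t := s^-1; have st : s * t = 1 by rewrite /t mulfV// gt_eqF.
transitivity ((s * t) ^+ 2); first by rewrite /s /spin; ring.
by rewrite st expr1n.
Qed.

(** The round metric 2 |df| / (1 + |f|^2) for f = p/q, where df = w / q^2. *)
Lemma hopfD_norm A B C D a b : 0 < spin A B C D ->
  \sum_(i < 3) (hopfD A B C D a b ord0 i) ^+ 2 =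
  4 * (a ^+ 2 + b ^+ 2) * (spin A B C D)^-1 ^+ 2.
Proof.
move=> s0; rewrite sum3E /hopfD !rowZE !row3E.
set s := spin _ _ _ _ in s0 *.
set t := s^-1; have st : s * t = 1 by rewrite /t mulfV// gt_eqF.
transitivity (4 * t ^+ 4 * ((a ^+ 2 + b ^+ 2) * s ^+ 2)).
  by rewrite /s /spin; ring.
transitivity (4 * (a ^+ 2 + b ^+ 2) * t ^+ 2 * (s * t) ^+ 2); first by ring.
by rewrite st; ring.
Qed.

(** The area form. With the order [u_y], [u_x] of the degree it is nonnegative when w_y = i w_x, so
    that rational maps count positively. *)
Lemma hopf_hopfD_triple A B C D a b a' b' : 0 < spin A B C D ->
  triple (hopf A B C D) (hopfD A B C D a' b') (hopfD A B C D a b) =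
  4 * (a * b' - b * a') * (spin A B C D)^-1 ^+ 2.
Proof.
move=> s0; rewrite /triple /c3 /hopf /hopfD !rowZE !row3E.
set s := spin _ _ _ _ in s0 *.
set t := s^-1; have st : s * t = 1 by rewrite /t mulfV// gt_eqF.
transitivity (4 * t ^+ 5 * ((a * b' - b * a') * s ^+ 3)); last first.
  transitivity (4 * (a * b' - b * a') * t ^+ 2 * (s * t) ^+ 3); first by ring.
  by rewrite st; ring.
by rewrite /s /spin; ring.
Qed.

Lemma hopf_dot_hopfD A B C D a b :
  hopf A B C D ord0 (inord 0) * hopfD A B C D a b ord0 (inord 0) +
  hopf A B C D ord0 (inord 1) * hopfD A B C D a b ord0 (inord 1) +
  hopf A B C D ord0 (inord 2) * hopfD A B C D a b ord0 (inord 2) = 0.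
Proof. by rewrite /hopf /hopfD !rowZE !row3E; ring. Qed.

(** (- b, a) is i (a + i b): multiplication of w by i is a quarter turn in the tangent plane, here -
    u ^ x. The two partial derivatives of a holomorphic map thus form, up to sign, a frame as in
    [conformal_gap]. *)
Lemma hopf_cross_hopfD A B C D a b : 0 < spin A B C D ->
  let u := hopf A B C D ord0 in let x := hopfD A B C D a b ord0 in
  let y := hopfD A B C D (- b) a ord0 in
  [/\ y (inord 0) = - (u (inord 1) * x (inord 2) - u (inord 2) * x (inord 1)),
      y (inord 1) = - (u (inord 2) * x (inord 0) - u (inord 0) * x (inord 2)) &
      y (inord 2) = - (u (inord 0) * x (inord 1) - u (inord 1) * x (inord 0))].
Proof.
move=> s0 /=; rewrite /hopf /hopfD !rowZE !row3E.
set s := spin _ _ _ _ in s0 *.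
set t := s^-1; have st : s * t = 1 by rewrite /t mulfV// gt_eqF.
have aux (Y Z : R) : Y * s = Z -> 2 * t ^+ 2 * Y = 2 * t ^+ 3 * Z.
  by move=> <-; transitivity (2 * t ^+ 2 * Y * (s * t)); [rewrite st mulr1|ring].
by split; rewrite (aux _ _ erefl) /s /spin; ring.
Qed.

(** The chordal distance 4 |p q' - p' q|^2 / (s s'), obtained from 2 - 2 u . v after writing 2 as 2
    (s t) (s' t') to make the identity homogeneous. *)
Lemma hopf_dist A B C D A' B' C' D' :
  0 < spin A B C D -> 0 < spin A' B' C' D' ->
  \sum_(i < 3) (hopf A B C D ord0 i - hopf A' B' C' D' ord0 i) ^+ 2 =
  4 * ((A * C' - B * D' - (A' * C - B' * D)) ^+ 2 +
       (A * D' + B * C' - (A' * D + B' * C)) ^+ 2) *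
  (spin A B C D)^-1 * (spin A' B' C' D')^-1.
Proof.
move=> s0 s0'; rewrite sum3E /hopf !rowZE !row3E.
set s := spin _ _ _ _ in s0 *; set s' := spin _ _ _ _ in s0' *.
set t := s^-1; have st : s * t = 1 by rewrite /t mulfV// gt_eqF.
set t' := s'^-1; have st' : s' * t' = 1 by rewrite /t' mulfV// gt_eqF.
pose h1 := 2 * (A * C + B * D); pose h2 := 2 * (B * C - A * D).
pose h3 := A ^+ 2 + B ^+ 2 - C ^+ 2 - D ^+ 2.
pose k1 := 2 * (A' * C' + B' * D'); pose k2 := 2 * (B' * C' - A' * D').
pose k3 := A' ^+ 2 + B' ^+ 2 - C' ^+ 2 - D' ^+ 2.
rewrite -/h1 -/h2 -/h3 -/k1 -/k2 -/k3.
have eh : h1 ^+ 2 + h2 ^+ 2 + h3 ^+ 2 = s ^+ 2 by rewrite /h1 /h2 /h3 /s /spin; ring.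
have ek : k1 ^+ 2 + k2 ^+ 2 + k3 ^+ 2 = s' ^+ 2 by rewrite /k1 /k2 /k3 /s' /spin; ring.
transitivity ((h1 ^+ 2 + h2 ^+ 2 + h3 ^+ 2) * t ^+ 2 +
  (k1 ^+ 2 + k2 ^+ 2 + k3 ^+ 2) * t' ^+ 2 -
  2 * (h1 * k1 + h2 * k2 + h3 * k3) * t * t'); first by ring.
rewrite eh ek; transitivity ((s * t) ^+ 2 + (s' * t') ^+ 2 -
  2 * (h1 * k1 + h2 * k2 + h3 * k3) * t * t'); first by ring.
rewrite st st'.
transitivity (2 * (s * t) * (s' * t') - 2 * (h1 * k1 + h2 * k2 + h3 * k3) * t * t').
  by rewrite st st'; ring.
by rewrite /h1 /h2 /h3 /k1 /k2 /k3 /s /s' /spin; ring.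
Qed.

(** [conformal_gap] with denominators cleared: g is the squared gradient of the difference of two
    maps with w_y = i w_x. *)
Lemma hopf_conformal_gap A B C D A' B' C' D' a b a' b' g :
  0 < spin A B C D -> 0 < spin A' B' C' D' ->
  g = \sum_(i < 3) ((hopfD A B C D a b ord0 i - hopfD A' B' C' D' a' b' ord0 i) ^+ 2 +
    (hopfD A B C D (- b) a ord0 i - hopfD A' B' C' D' (- b') a' ord0 i) ^+ 2) ->
  4 * ((A * C' - B * D' - (A' * C - B' * D)) ^+ 2 +
       (A * D' + B * C' - (A' * D + B' * C)) ^+ 2) * (a ^+ 2 + b ^+ 2) <=
  g * spin A B C D ^+ 3 * spin A' B' C' D'.
Proof.
move=> s0 s0' ->.
have Hu := hopf_unit s0; have Hv := hopf_unit s0'; rewrite !sum3E in Hu Hv.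
have := conformal_gap Hu Hv (hopf_dot_hopfD A B C D a b) (hopf_dot_hopfD A' B' C' D' a' b').
have [c1 c2 c3] := hopf_cross_hopfD a b s0.
have [c1' c2' c3'] := hopf_cross_hopfD a' b' s0'.
have := hopf_dist s0 s0'; rewrite !sum3E => ->.
have := hopfD_norm a b s0; rewrite !sum3E => ->.
rewrite c1 c2 c3 c1' c2' c3'.
set s := spin _ _ _ _ in s0 *; set s' := spin _ _ _ _ in s0' *.
set X := (A * C' - _ - _) ^+ 2 + _.
set G := (4 * (_ + _ + _ + _ + _ + _)).
move=> H; rewrite -subr_ge0.
have {}H : 0 <= s ^+ 3 * s' * (G - 4 * X / s / s' * (4 * (a ^+ 2 + b ^+ 2) * s^-1 ^+ 2)).
  by rewrite !mulr_ge0 ?subr_ge0 ?exprn_ge0// ltW.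
rewrite -(pmulr_rge0 (x := 4))//; apply: le_trans H _; rewrite le_eqVlt; apply/orP; left.
apply/eqP; rewrite /G; field.
by rewrite !gt_eqF.
Qed.

End HopfAlgebra.

(** * Sphere-valued fields and the connection form *)

Section HopfFields.
Context {R : realType}.
Implicit Types (f fx fy : R * R -> 'rV[R]_3) (A B C D : R * R -> R).

Definition hasgrad3 f fx fy := forall i : 'I_3,
  hasgrad (fun z => f z ord0 i) (fun z => fx z ord0 i) (fun z => fy z ord0 i).

Lemma hasgrad3_differentiable f fx fy z : hasgrad3 f fx fy -> differentiable f z.
Proof.
move=> hf.
have -> : f = \sum_(i < 3) (fun z => f z ord0 i *: delta_mx ord0 i).
  by apply/funext => w; rewrite fct_sumE [LHS]row_sum_delta.
apply: differentiable_sum => i; apply: differentiableZl.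
by have [] := hf i.
Qed.

Lemma hasgrad3_dx f fx fy : hasgrad3 f fx fy -> dx f = fx.
Proof.
move=> hf; apply/funext => z; rewrite /dx derive_mx.
  by apply/rowP => i; rewrite mxE; have [_ -> _ _] := hf i.
exact/diff_derivable/(hasgrad3_differentiable _ hf).
Qed.

Lemma hasgrad3_dy f fx fy : hasgrad3 f fx fy -> dy f = fy.
Proof.
move=> hf; apply/funext => z; rewrite /dy derive_mx.
  by apply/rowP => i; rewrite mxE; have [_ _ -> _] := hf i.
exact/diff_derivable/(hasgrad3_differentiable _ hf).
Qed.

Lemma hasgrad3B f fx fy g gx gy : hasgrad3 f fx fy -> hasgrad3 g gx gy ->
  hasgrad3 (fun z => f z - g z) (fun z => fx z - gx z) (fun z => fy z - gy z).
Proof.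
move=> hf hg i.
have E (u v : R * R -> 'rV[R]_3) :
    (fun z => (u z - v z) ord0 i) = (fun z => u z ord0 i - v z ord0 i).
  by apply/funext => z; rewrite !mxE.
by rewrite !E; apply: hasgradB.
Qed.

Lemma gradsq_hasgrad3 f fx fy z : hasgrad3 f fx fy ->
  gradsq f z = \sum_(i < 3) ((fx z ord0 i) ^+ 2 + (fy z ord0 i) ^+ 2).
Proof. by move=> hf; rewrite /gradsq (hasgrad3_dx hf) (hasgrad3_dy hf). Qed.

(** Real and imaginary parts of the Wronskian p' q - p q'. *)
Definition wre (a b c d a' b' c' d' : R) := a' * c - b' * d - a * c' + b * d'.
Definition wim (a b c d a' b' c' d' : R) := a' * d + b' * c - a * d' - b * c'.

Lemma hasgrad_spin A Ax Ay B Bx By C Cx Cy D Dx Dy :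
  hasgrad A Ax Ay -> hasgrad B Bx By -> hasgrad C Cx Cy -> hasgrad D Dx Dy ->
  hasgrad (fun z => spin (A z) (B z) (C z) (D z))
    (fun z => 2 * (A z * Ax z + B z * Bx z + C z * Cx z + D z * Dx z))
    (fun z => 2 * (A z * Ay z + B z * By z + C z * Cy z + D z * Dy z)).
Proof.
move=> hA hB hC hD.
have := hasgradD (hasgradD (hasgradD (hasgradM hA hA) (hasgradM hB hB))
  (hasgradM hC hC)) (hasgradM hD hD).
by move/hasgradE; apply => z; ring.
Qed.

Lemma hasgrad_quotient A Ax Ay B Bx By : (forall z, 0 < B z) ->
  hasgrad A Ax Ay -> hasgrad B Bx By ->
  hasgrad (fun z => (B z)^-1 * A z)
    (fun z => (B z * Ax z - A z * Bx z) * (B z)^-1 ^+ 2)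
    (fun z => (B z * Ay z - A z * By z) * (B z)^-1 ^+ 2).
Proof.
move=> B0 hA hB; move: (hasgradM (hasgradV B0 hB) hA) => /hasgradE; apply=> z.
- by field; rewrite gt_eqF.
- by field; rewrite gt_eqF.
Qed.

Lemma hasgrad3_hopf A Ax Ay B Bx By C Cx Cy D Dx Dy :
  (forall z, 0 < spin (A z) (B z) (C z) (D z)) ->
  hasgrad A Ax Ay -> hasgrad B Bx By -> hasgrad C Cx Cy -> hasgrad D Dx Dy ->
  hasgrad3 (fun z => hopf (A z) (B z) (C z) (D z))
    (fun z => hopfD (A z) (B z) (C z) (D z)
       (wre (A z) (B z) (C z) (D z) (Ax z) (Bx z) (Cx z) (Dx z))
       (wim (A z) (B z) (C z) (D z) (Ax z) (Bx z) (Cx z) (Dx z)))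
    (fun z => hopfD (A z) (B z) (C z) (D z)
       (wre (A z) (B z) (C z) (D z) (Ay z) (By z) (Cy z) (Dy z))
       (wim (A z) (B z) (C z) (D z) (Ay z) (By z) (Cy z) (Dy z))).
Proof.
move=> s0 hA hB hC hD i.
have hs := hasgrad_spin hA hB hC hD.
have h2 := hasgrad_cst (2 : R).
have [->|[->|->]] : i = inord 0 \/ i = inord 1 \/ i = inord 2.
  case: i => [[|[|[|//]]] ?]; [left|right;left|right;right];
  by apply/val_inj; rewrite /= inordK.
- have -> : (fun z => hopf (A z) (B z) (C z) (D z) ord0 (inord 0)) = (fun z =>
      (spin (A z) (B z) (C z) (D z))^-1 * (2 * (A z * C z + B z * D z))).
    by apply/funext => z; rewrite rowZE row3E.
  have := hasgrad_quotient s0 (hasgradM h2 (hasgradD (hasgradM hA hC) (hasgradM hB hD))) hs.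
  by move/hasgradE; apply => z; rewrite rowZE row3E /spin /wre /wim; ring.
- have -> : (fun z => hopf (A z) (B z) (C z) (D z) ord0 (inord 1)) = (fun z =>
      (spin (A z) (B z) (C z) (D z))^-1 * (2 * (B z * C z - A z * D z))).
    by apply/funext => z; rewrite rowZE row3E.
  have := hasgrad_quotient s0 (hasgradM h2 (hasgradB (hasgradM hB hC) (hasgradM hA hD))) hs.
  by move/hasgradE; apply => z; rewrite rowZE row3E /spin /wre /wim; ring.
- have -> : (fun z => hopf (A z) (B z) (C z) (D z) ord0 (inord 2)) = (fun z =>
      (spin (A z) (B z) (C z) (D z))^-1 *
      (A z * A z + B z * B z - C z * C z - D z * D z)).
    by apply/funext => z; rewrite rowZE row3E.
  have := hasgrad_quotient s0 (hasgradB (hasgradB (hasgradD (hasgradM hA hA)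
    (hasgradM hB hB)) (hasgradM hC hC)) (hasgradM hD hD)) hs.
  by move/hasgradE; apply => z; rewrite rowZE row3E /spin /wre /wim; ring.
Qed.

(* The connection form of the Hopf bundle, pulled back along (p, q) and evaluated
   on the direction ' : its curl is the pulled back area form of the sphere. *)
Definition cform (a b c d a' b' c' d' : R) : R :=
  (spin a b c d)^-1 * (2 * (a * b' - b * a' + c * d' - d * c')).

Definition cformD (a b c d a' b' c' d' a1 b1 c1 d1 a2 b2 c2 d2 : R) : R :=
  (spin a b c d * (2 * (a1 * b' + a * b2 - b1 * a' - b * a2 +
      c1 * d' + c * d2 - d1 * c' - d * c2)) -
    2 * (a * b' - b * a' + c * d' - d * c') *
    (2 * (a * a1 + b * b1 + c * c1 + d * d1))) * (spin a b c d)^-1 ^+ 2.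

Lemma hasgrad_cform A Ax Ay B Bx By C Cx Cy D Dx Dy
    A' A'x A'y B' B'x B'y C' C'x C'y D' D'x D'y :
  (forall z, 0 < spin (A z) (B z) (C z) (D z)) ->
  hasgrad A Ax Ay -> hasgrad B Bx By -> hasgrad C Cx Cy -> hasgrad D Dx Dy ->
  hasgrad A' A'x A'y -> hasgrad B' B'x B'y -> hasgrad C' C'x C'y -> hasgrad D' D'x D'y ->
  hasgrad (fun z => cform (A z) (B z) (C z) (D z) (A' z) (B' z) (C' z) (D' z))
    (fun z => cformD (A z) (B z) (C z) (D z) (A' z) (B' z) (C' z) (D' z)
      (Ax z) (Bx z) (Cx z) (Dx z) (A'x z) (B'x z) (C'x z) (D'x z))
    (fun z => cformD (A z) (B z) (C z) (D z) (A' z) (B' z) (C' z) (D' z)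
      (Ay z) (By z) (Cy z) (Dy z) (A'y z) (B'y z) (C'y z) (D'y z)).
Proof.
move=> s0 hA hB hC hD hA' hB' hC' hD'.
have hs := hasgrad_spin hA hB hC hD.
have h2 := hasgrad_cst (2 : R).
have := hasgrad_quotient s0 (hasgradM h2 (hasgradB (hasgradD (hasgradB
  (hasgradM hA hB') (hasgradM hB hA')) (hasgradM hC hD')) (hasgradM hD hC'))) hs.
by move/hasgradE; apply => z; rewrite /cformD; ring.
Qed.

(** The mixed second derivatives [a12], ..., [d12] are common to both terms and cancel, leaving the
    area density of [hopf_hopfD_triple]. Hence the integral of the area form over a square is a
    boundary term. *)
Lemma cformD_curl (a b c d a1 b1 c1 d1 a2 b2 c2 d2 a12 b12 c12 d12 : R) :
  cformD a b c d a2 b2 c2 d2 a1 b1 c1 d1 a12 b12 c12 d12 -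
  cformD a b c d a1 b1 c1 d1 a2 b2 c2 d2 a12 b12 c12 d12 =
  4 * (wre a b c d a1 b1 c1 d1 * wim a b c d a2 b2 c2 d2 -
       wim a b c d a1 b1 c1 d1 * wre a b c d a2 b2 c2 d2) * (spin a b c d)^-1 ^+ 2.
Proof. by rewrite /cformD -mulrBl; congr (_ * _); rewrite /spin /wre /wim; ring. Qed.

End HopfFields.

(** * The cutoff function *)

Section Cutoff.
Context {R : realType}.
Implicit Types (t : R) (f fx fy : R * R -> R).

Definition pos t : R := Num.max t 0.

Lemma pos_id t : 0 <= t -> pos t = t. Proof. by move=> t0; rewrite /pos max_l. Qed.
Lemma pos_0 t : t <= 0 -> pos t = 0. Proof. by move=> t0; rewrite /pos max_r. Qed.

Lemma continuous_pos : continuous pos.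
Proof. by move=> t; apply: continuous_max; [exact: cvg_id|exact: cvg_cst]. Qed.

(** An explicit quadratic remainder treats the kink of [pos] like any other point: for the square of
    [pos] it is checked sign by sign. *)
Lemma is_derive_quadratic_error (f : R -> R) (t l : R) :
  (forall h, `|f (h + t) - f t - l * h| <= h ^+ 2) -> is_derive t 1 f l.
Proof.
move=> Hf.
have cvl : (h^-1 *: (f (h *: 1 + t) - f t) @[h --> 0^'] --> l)%classic.
  apply/cvgrPdist_le => e e0; near=> h.
  have h0 : h != 0 by near: h; exact: nbhs_dnbhs_neq.
  have he : `|h| <= e by near: h; apply: dnbhs0_le.
  rewrite [h *: 1]mulr1 distrC.
  have -> : h^-1 *: (f (h + t) - f t) - l = h^-1 * (f (h + t) - f t - l * h).
    by rewrite /GRing.scale/=; field.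
  rewrite normrM normfV ler_pdivrMl ?normr_gt0//.
  apply: le_trans (Hf h) _; rewrite -real_normK ?num_real// expr2.
  exact: ler_pM.
split; first by apply/cvg_ex; exists l.
exact: cvg_lim cvl.
Unshelve. all: by end_near. Qed.

Lemma is_derive_pos2 t : is_derive t 1 (fun t => pos t ^+ 2) (2 * pos t).
Proof.
apply: is_derive_quadratic_error => h; rewrite ler_norml.
have [h0|h0] := leP 0 (h + t); have [t0|t0] := leP 0 t.
- by rewrite !pos_id//; nra.
- by rewrite (pos_id h0) (pos_0 (ltW t0)); nra.
- by rewrite (pos_0 (ltW h0)) (pos_id t0); nra.
- by rewrite (pos_0 (ltW h0)) (pos_0 (ltW t0)); nra.
Qed.

Definition kap t : R := pos t ^+ 3.
Definition kap1 t : R := 3 * pos t ^+ 2.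
Definition kap2 t : R := 6 * pos t.

Lemma is_derive_kap t : is_derive t 1 kap (kap1 t).
Proof.
have -> : kap = (fun t => t) * (fun t => pos t ^+ 2).
  apply/funext => x; rewrite /kap /= fctE exprS.
  by have [x0|x0] := leP 0 x; [rewrite pos_id|rewrite pos_0 ?ltW// expr0n/= !mulr0].
apply: is_derive_eq; first by apply: is_deriveM; exact: is_derive_pos2.
rewrite /GRing.scale/= /kap1.
by have [t0|t0] := leP 0 t; [rewrite pos_id//; ring|rewrite pos_0 ?ltW//; ring].
Qed.

Lemma is_derive_kap1 t : is_derive t 1 kap1 (kap2 t).
Proof.
have -> : kap1 = 3 \*: (fun t => pos t ^+ 2) by [].
have d2 := is_derive_pos2 t; apply: is_derive_eq.
by rewrite /GRing.scale/= /kap2; ring.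
Qed.

(** Since [kap] vanishes to third order at 0, this step from 1 to 0 is of class C^2 at both ends;
    the mixed second derivatives in [cformD_curl] require two derivatives. *)
Definition cutoff t : R := kap (1 - kap t).
Definition cutoff1 t : R := - kap1 (1 - kap t) * kap1 t.
Definition cutoff2 t : R := kap2 (1 - kap t) * kap1 t ^+ 2 - kap1 (1 - kap t) * kap2 t.

Lemma cutoff_0 t : t <= 0 -> cutoff t = 1.
Proof. by move=> t0; rewrite /cutoff /kap (pos_0 t0) expr0n/= subr0 pos_id// expr1n. Qed.

Lemma cutoff_1 t : 1 <= t -> cutoff t = 0.
Proof.
move=> t1; rewrite /cutoff /kap pos_0 ?expr0n// pos_id ?(le_trans ler01)//.
by rewrite subr_le0 exprn_ege1.
Qed.

Lemma cutoff1_0 t : t <= 0 -> cutoff1 t = 0.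
Proof. by move=> t0; rewrite /cutoff1 {2}/kap1 (pos_0 t0) expr0n/= !mulr0. Qed.

Lemma cutoff1_1 t : 1 <= t -> cutoff1 t = 0.
Proof.
move=> t1; rewrite /cutoff1 {1}/kap1 pos_0 ?expr0n ?mulr0 ?oppr0 ?mul0r//.
by rewrite /kap subr_le0 exprn_ege1// pos_id// (le_trans ler01).
Qed.

(** Both factors [kap1] are at most 3 on the unit interval, and 81 = (3 * 3)^2. *)
Lemma cutoff1_sqr_le t : cutoff1 t ^+ 2 <= 81.
Proof.
have [t0|t0] := leP t 0; first by rewrite cutoff1_0// expr0n.
have [t1|t1] := leP 1 t; first by rewrite cutoff1_1// expr0n.
rewrite /cutoff1 mulNr sqrrN /kap1 /kap (pos_id (ltW t0)).
have k0 : 0 <= t ^+ 3 by rewrite exprn_ge0// ltW.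
have k1 : t ^+ 3 <= 1 by rewrite exprn_ile1// ltW.
rewrite pos_id ?subr_ge0//.
have a1 : (1 - t ^+ 3) ^+ 2 <= 1 by rewrite exprn_ile1//; lra.
have a2 : t ^+ 2 <= 1 by rewrite exprn_ile1// ltW.
have a3 : (1 - t ^+ 3) ^+ 2 * t ^+ 2 <= 1 by rewrite mulr_ile1 ?sqr_ge0.
have -> : 3 * (1 - t ^+ 3) ^+ 2 * (3 * t ^+ 2) = 9 * ((1 - t ^+ 3) ^+ 2 * t ^+ 2) by ring.
set X := _ * _ in a3 *.
have X0 : 0 <= X by rewrite mulr_ge0 ?sqr_ge0.
by rewrite exprMn; nra.
Qed.

Lemma hasgrad_kap f fx fy : hasgrad f fx fy ->
  hasgrad (fun z => kap (f z)) (fun z => kap1 (f z) * fx z) (fun z => kap1 (f z) * fy z) /\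
  hasgrad (fun z => kap1 (f z)) (fun z => kap2 (f z) * fx z) (fun z => kap2 (f z) * fy z).
Proof.
move=> hf; have [_ _ _ [cf _ _]] := hf.
have cp := contm_comp continuous_pos cf.
have ck : contm (fun z => kap (f z)) by exact: contmX.
have ck1 : contm (fun z => kap1 (f z)) by apply: contmM; [exact: contm_cst|exact: contmX].
have ck2 : contm (fun z => kap2 (f z)) by apply: contmM => //; exact: contm_cst.
split; apply: hasgrad_comp => // z; [exact: is_derive_kap|exact: is_derive_kap1].
Qed.

Lemma hasgrad_cutoff f fx fy : hasgrad f fx fy ->
  hasgrad (fun z => cutoff (f z)) (fun z => cutoff1 (f z) * fx z) (fun z => cutoff1 (f z) * fy z) /\
  hasgrad (fun z => cutoff1 (f z)) (fun z => cutoff2 (f z) * fx z) (fun z => cutoff2 (f z) * fy z).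
Proof.
move=> hf; have [h0 h1] := hasgrad_kap hf.
have [g0 g1] := hasgrad_kap (hasgradB (hasgrad_cst 1) h0).
split.
  by apply: hasgradE g0 _ _ => z; rewrite /cutoff1; ring.
by apply: hasgradE (hasgradM (hasgradN g1) h1) _ _ => z; rewrite /cutoff2; ring.
Qed.

Lemma hasgrad_ln f fx fy : (forall z, 0 < f z) -> hasgrad f fx fy ->
  hasgrad (fun z => ln (f z)) (fun z => (f z)^-1 * fx z) (fun z => (f z)^-1 * fy z).
Proof.
move=> f0 hf; have [_ _ _ [[cf mf] _ _]] := hf.
apply: (@hasgrad_comp R (@ln R) (fun t => t^-1) f fx fy hf) => [z||].
- exact: is_derive1_ln.
- split; last by apply: measurableT_comp.
  by move=> z; apply: continuous_comp; [exact: cf|exact: continuous_ln].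
- exact: contmV.
Qed.

End Cutoff.

(** * The two-bubble map *)

Section TwoBubbles.
Context {R : realType} (L : R) (L1 : 1 <= L).
Implicit Types z : R * R.

Definition dlt : R := expR (- L).
Definition rsq z : R := z.1 ^+ 2 + z.2 ^+ 2.
(** The term [dlt ^+ 2] keeps the logarithm smooth at the origin and at least - 2 L, and ln(|z|^2 +
    d^2) is still subharmonic, with laplacian 4 d^2 / [Sd]^2. *)
Definition Sd z : R := rsq z + dlt ^+ 2.
Definition psi z : R := ln (Sd z).
Definition tau z : R := 1 + L^-1 * psi z.
Definition phi z : R := cutoff (tau z).
(* grad phi = 2 phm z and grad phm = 2 phn z, phi being radial. *)
Definition phm z : R := cutoff1 (tau z) * (L * Sd z)^-1.
Definition phn z : R := cutoff2 (tau z) * (L * Sd z)^-1 ^+ 2 - phm z * (Sd z)^-1.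

Lemma L_gt0 : 0 < L. Proof. exact: lt_le_trans ltr01 L1. Qed.
Lemma dlt_gt0 : 0 < dlt. Proof. exact: expR_gt0. Qed.
Lemma rsq_ge0 z : 0 <= rsq z. Proof. by rewrite addr_ge0// sqr_ge0. Qed.
Lemma Sd_gt0 z : 0 < Sd z.
Proof. by rewrite ltr_wpDl ?rsq_ge0 ?exprn_gt0 ?dlt_gt0. Qed.

(** From e^L >= 1 + L; the later smallness conditions on [dlt] are drawn from this bound. *)
Lemma dlt_le : dlt * (1 + L) <= 1.
Proof.
by rewrite /dlt expRN mulrC ler_pdivrMr ?expR_gt0// mul1r expR_ge1Dx.
Qed.

Lemma dlt_half : dlt <= 2^-1.
Proof. by have := dlt_le; have := dlt_gt0; have := L1; nra. Qed.

Local Notation hx := (@hasgrad_fst R).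
Local Notation hy := (@hasgrad_snd R).

Lemma hasgrad_rsq : hasgrad rsq (fun z => 2 * z.1) (fun z => 2 * z.2).
Proof.
have := hasgradD (hasgradM hx hx) (hasgradM hy hy).
by move/hasgradE; apply => z; ring.
Qed.

Lemma hasgrad_Sd : hasgrad Sd (fun z => 2 * z.1) (fun z => 2 * z.2).
Proof.
have := hasgradD hasgrad_rsq (hasgrad_cst (dlt ^+ 2)).
by move/hasgradE; apply => z; rewrite addr0.
Qed.

Lemma hasgrad_psi :
  hasgrad psi (fun z => (Sd z)^-1 * (2 * z.1)) (fun z => (Sd z)^-1 * (2 * z.2)).
Proof. exact: hasgrad_ln Sd_gt0 hasgrad_Sd. Qed.

Lemma hasgrad_tau : hasgrad tau (fun z => (L * Sd z)^-1 * (2 * z.1))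
  (fun z => (L * Sd z)^-1 * (2 * z.2)).
Proof.
have := hasgradD (hasgrad_cst 1) (hasgradM (hasgrad_cst L^-1) hasgrad_psi).
by move/hasgradE; apply => z; rewrite invfM; ring.
Qed.

Lemma hasgrad_phi :
  hasgrad phi (fun z => 2 * z.1 * phm z) (fun z => 2 * z.2 * phm z).
Proof.
have [+ _] := hasgrad_cutoff hasgrad_tau.
by move/hasgradE; apply => z; rewrite /phm; ring.
Qed.

Lemma hasgrad_phm :
  hasgrad phm (fun z => 2 * z.1 * phn z) (fun z => 2 * z.2 * phn z).
Proof.
have [_ h1] := hasgrad_cutoff hasgrad_tau.
have LS0 z : 0 < L * Sd z by rewrite mulr_gt0 ?L_gt0 ?Sd_gt0.
have := hasgradM h1 (hasgradV LS0 (hasgradM (hasgrad_cst L) hasgrad_Sd)).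
move/hasgradE; apply => z; rewrite /phn /phm; field;
by rewrite (gt_eqF L_gt0) gt_eqF ?Sd_gt0.
Qed.

Lemma phi_outer z : 1 <= Sd z -> phi z = 0 /\ phm z = 0.
Proof.
move=> S1; have t1 : 1 <= tau z.
  by rewrite lerDl mulr_ge0 ?invr_ge0 ?(ltW L_gt0)// ln_ge0.
by rewrite /phi /phm cutoff_1// cutoff1_1// mul0r.
Qed.

Lemma phi_inner z : Sd z <= dlt -> phi z = 1 /\ phm z = 0.
Proof.
move=> S1; have t0 : tau z <= 0.
  rewrite /tau -lerBrDl sub0r mulrC ler_pdivrMr ?L_gt0// mulN1r.
  by rewrite /psi -[leRHS]expRK ler_ln ?posrE ?Sd_gt0 ?expR_gt0.
by rewrite /phi /phm cutoff_0// cutoff1_0// mul0r.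
Qed.

(* The numerator z^2 + phi z + dlt; the denominator is z. *)
Definition pre z : R := z.1 ^+ 2 - z.2 ^+ 2 + phi z * z.1 + dlt.
Definition pim z : R := 2 * z.1 * z.2 + phi z * z.2.
Definition pre_x z : R := 2 * z.1 + phi z + 2 * z.1 ^+ 2 * phm z.
Definition pre_y z : R := - 2 * z.2 + 2 * z.1 * z.2 * phm z.
Definition pim_x z : R := 2 * z.2 + 2 * z.1 * z.2 * phm z.
Definition pim_y z : R := 2 * z.1 + phi z + 2 * z.2 ^+ 2 * phm z.
Definition pre_xy z : R := 2 * z.2 * phm z + 4 * z.1 ^+ 2 * z.2 * phn z.
Definition pim_xy z : R := 2 + 2 * z.1 * phm z + 4 * z.1 * z.2 ^+ 2 * phn z.

Lemma hasgrad_pre : hasgrad pre pre_x pre_y.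
Proof.
have := hasgradD (hasgradD (hasgradB (hasgradM hx hx) (hasgradM hy hy))
  (hasgradM hasgrad_phi hx)) (hasgrad_cst dlt).
by move/hasgradE; apply => z; rewrite /pre_x /pre_y; ring.
Qed.

Lemma hasgrad_pim : hasgrad pim pim_x pim_y.
Proof.
have := hasgradD (hasgradM (hasgradM (hasgrad_cst 2) hx) hy) (hasgradM hasgrad_phi hy).
by move/hasgradE; apply => z; rewrite /pim_x /pim_y; ring.
Qed.

(** The mixed derivative is explicit because [pre_x] and [pre_y] must share it in [cformD_curl]; the
    pure second derivative stays existential. *)
Lemma hasgrad_pre_x : exists pre_xx, hasgrad pre_x pre_xx pre_xy.
Proof.
eexists.
have := hasgradD (hasgradD (hasgradM (hasgrad_cst 2) hx) hasgrad_phi)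
  (hasgradM (hasgradM (hasgrad_cst 2) (hasgradM hx hx)) hasgrad_phm).
by move/hasgradE; apply => z //; rewrite /pre_xy; ring.
Qed.

Lemma hasgrad_pre_y : exists pre_yy, hasgrad pre_y pre_xy pre_yy.
Proof.
eexists.
have := hasgradD (hasgradM (hasgrad_cst (- 2)) hy)
  (hasgradM (hasgradM (hasgradM (hasgrad_cst 2) hx) hy) hasgrad_phm).
by move/hasgradE; apply => z //; rewrite /pre_xy; ring.
Qed.

Lemma hasgrad_pim_x : exists pim_xx, hasgrad pim_x pim_xx pim_xy.
Proof.
eexists.
have := hasgradD (hasgradM (hasgrad_cst 2) hy)
  (hasgradM (hasgradM (hasgradM (hasgrad_cst 2) hx) hy) hasgrad_phm).
by move/hasgradE; apply => z //; rewrite /pim_xy; ring.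
Qed.

Lemma hasgrad_pim_y : exists pim_yy, hasgrad pim_y pim_xy pim_yy.
Proof.
eexists.
have := hasgradD (hasgradD (hasgradM (hasgrad_cst 2) hx) hasgrad_phi)
  (hasgradM (hasgradM (hasgrad_cst 2) (hasgradM hy hy)) hasgrad_phm).
by move/hasgradE; apply => z //; rewrite /pim_xy; ring.
Qed.

Definition bspin z : R := spin (pre z) (pim z) z.1 z.2.

Lemma rsq_le_bspin z : rsq z <= bspin z.
Proof.
rewrite /bspin /spin /rsq -subr_ge0.
have -> : pre z ^+ 2 + pim z ^+ 2 + z.1 ^+ 2 + z.2 ^+ 2 - (z.1 ^+ 2 + z.2 ^+ 2) =
  pre z ^+ 2 + pim z ^+ 2 by ring.
by rewrite addr_ge0 ?sqr_ge0.
Qed.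

(** The denominator vanishes only at the origin, where the numerator is [dlt]. *)
Lemma bspin_gt0 z : 0 < bspin z.
Proof.
have [s0|s0] := ltP 0 (rsq z); first exact: lt_le_trans (rsq_le_bspin z).
have {s0} : rsq z == 0 by rewrite eq_le s0 rsq_ge0.
rewrite /rsq paddr_eq0 ?sqr_ge0// !sqrf_eq0 => /andP[/eqP z1 /eqP z2].
have -> : bspin z = dlt ^+ 2 by rewrite /bspin /spin /pre /pim z1 z2; ring.
by rewrite exprn_gt0// dlt_gt0.
Qed.

Definition bub z : 'rV[R]_3 := hopf (pre z) (pim z) z.1 z.2.
Definition wxre z : R := wre (pre z) (pim z) z.1 z.2 (pre_x z) (pim_x z) 1 0.
Definition wxim z : R := wim (pre z) (pim z) z.1 z.2 (pre_x z) (pim_x z) 1 0.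
Definition wyre z : R := wre (pre z) (pim z) z.1 z.2 (pre_y z) (pim_y z) 0 1.
Definition wyim z : R := wim (pre z) (pim z) z.1 z.2 (pre_y z) (pim_y z) 0 1.

Lemma hasgrad3_bub : hasgrad3 bub
  (fun z => hopfD (pre z) (pim z) z.1 z.2 (wxre z) (wxim z))
  (fun z => hopfD (pre z) (pim z) z.1 z.2 (wyre z) (wyim z)).
Proof. exact: hasgrad3_hopf bspin_gt0 hasgrad_pre hasgrad_pim hx hy. Qed.

Definition defect z : R := 8 * phm z ^+ 2 * rsq z ^+ 3 * (bspin z)^-1 ^+ 2.

Definition btriple z : R := triple (bub z) (dy bub z) (dx bub z).

Lemma btripleE z :
  btriple z = 4 * (wxre z * wyim z - wxim z * wyre z) * (bspin z)^-1 ^+ 2.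
Proof.
rewrite /btriple (hasgrad3_dx hasgrad3_bub) (hasgrad3_dy hasgrad3_bub).
exact: hopf_hopfD_triple (bspin_gt0 z).
Qed.

(* The failure of conformality |w_x + i w_y|^2 comes from the d-bar derivative
   of phi alone. *)
Lemma gradsq_bub z : 2^-1 * gradsq bub z = btriple z + defect z.
Proof.
rewrite (gradsq_hasgrad3 _ hasgrad3_bub) big_split/=.
rewrite !(hopfD_norm _ _ (bspin_gt0 z)) btripleE /defect -/(bspin z).
set t := (bspin z)^-1 ^+ 2.
transitivity (2 * (wxre z ^+ 2 + wxim z ^+ 2 + (wyre z ^+ 2 + wyim z ^+ 2)) * t).
  by field.
rewrite -mulrDl; congr (_ * _).
by rewrite /wxre /wxim /wyre /wyim /wre /wim /pre /pim /pre_x /pre_y /pim_x /pim_y /rsq; field.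
Qed.

End TwoBubbles.

(** * Energy and degree *)

Section BubbleEnergy.
Local Open Scope classical_set_scope.
Context {R : realType} (L : R) (L1 : 1 <= L).
Implicit Types (z : R * R) (T : R).

Local Notation mu := (@lebesgue_measure R).
Local Notation mu2 := (mu \x mu)%E.

Lemma continuous_integrable_itv (G : R -> R) (a b : R) : continuous G ->
  mu.-integrable `[a, b] (EFin \o G).
Proof.
move=> cG; apply: continuous_compact_integrable; first exact: segment_compact.
exact: continuous_subspaceT.
Qed.

Lemma Rintegral_sup_dist (G K : R -> R) (a b c : R) : a <= b -> continuous G -> continuous K ->
  (forall y, a <= y <= b -> `|G y - K y| <= c) ->
  `|Rintegral mu `[a, b] G - Rintegral mu `[a, b] K| <= c * (b - a).
Proof.
move=> ab cG cK Hc.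
have mI : measurable (`[a, b] : set (measurableTypeR R)) by exact: measurable_itv.
have iG := continuous_integrable_itv a b cG.
have iK := continuous_integrable_itv a b cK.
have cGK : continuous (fun y => G y - K y) by move=> y; apply: cvgB; [exact: cG|exact: cK].
have iGK := continuous_integrable_itv a b cGK.
rewrite -RintegralB//.
apply: le_trans (le_normr_Rintegral _ iGK) _ => //.
have -> : c * (b - a) = Rintegral mu `[a, b] (fun=> c).
  rewrite Rintegral_cst//; congr (_ * _).
  transitivity (fine (mu `[a, b])); last by [].
  rewrite lebesgue_measure_itv/= lte_fin; case: ltP => //= ba.
  by apply/eqP; rewrite subr_eq0 eq_le ab ba.
apply: le_Rintegral => //.
- exact: integrable_norm iGK.
- by apply: continuous_integrable_itv; exact: cst_continuous.
Qed.

Lemma continuous_poisson T : 0 < T -> continuous (fun y : R => 8 * T / (T ^+ 2 + y ^+ 2)).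
Proof.
move=> T0 y; apply: cvgM; first exact: cvg_cst.
apply: cvgV; first by rewrite gt_eqF// ltr_wpDr ?sqr_ge0// exprn_gt0.
apply: cvgD; first exact: cvg_cst.
exact: exprn_continuous.
Qed.

(** The primitive is 8 atan(y / T), and 16 atan 1 = 4 pi whatever T: half of the total flux 8 pi for
    each pair of opposite sides. *)
Lemma Rintegral_poisson T : 0 < T ->
  Rintegral mu `[- T, T] (fun y => 8 * T / (T ^+ 2 + y ^+ 2)) = 4 * pi.
Proof.
move=> T0; have ab : - T < T by rewrite gt0_cp.
have T0' : T != 0 by rewrite gt_eqF.
have dF y : derivable (fun y => 8 * atan (T^-1 * y)) y 1 /\
    (fun y => 8 * atan (T^-1 * y))^`() y = 8 * T / (T ^+ 2 + y ^+ 2).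
  have d0 : is_derive y 1 ( *%R T^-1) T^-1.
    have -> : *%R T^-1 = T^-1 \*: (@id R) by [].
    by apply: is_derive_eq; rewrite /GRing.scale/= mulr1.
  have d1 := @is_derive1_comp R atan ( *%R T^-1) y _ _ (is_derive1_atan _) d0.
  have d2 : is_derive y 1 (fun y => 8 * atan (T^-1 * y)) (8 * T / (T ^+ 2 + y ^+ 2)).
    have -> : (fun y => 8 * atan (T^-1 * y)) = 8 \*: (atan \o *%R T^-1) by [].
    apply: is_derive_eq; rewrite /GRing.scale/=; field.
    by rewrite !gt_eqF// ?ltr_wpDr ?sqr_ge0// ?exprn_gt0//.
  by split; [exact: ex_derive|rewrite derive1E derive_val].
rewrite /Rintegral (ftc_everywhere ab (continuous_poisson T0) dF)/=.
by rewrite mulrN mulVf//= atanN atan1; field.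
Qed.

(** The dx component of the connection form, [bQ] being the dy component; the denominator z has
    derivatives 1 and i. *)
Definition bP z : R := cform (pre L z) (pim L z) z.1 z.2 (pre_x L z) (pim_x L z) 1 0.
Definition bQ z : R := cform (pre L z) (pim L z) z.1 z.2 (pre_y L z) (pim_y L z) 0 1.

Lemma green_btriple : exists Px Py Qx Qy, [/\ hasgrad bP Px Py, hasgrad bQ Qx Qy &
  forall z, btriple L z = Qx z - Py z].
Proof.
have [pxx hpx] := hasgrad_pre_x L1; have [pyy hpy] := hasgrad_pre_y L1.
have [qxx hqx] := hasgrad_pim_x L1; have [qyy hqy] := hasgrad_pim_y L1.
have hp := hasgrad_pre L; have hq := hasgrad_pim L.
have hx := @hasgrad_fst R; have hy := @hasgrad_snd R.
have h1 := @hasgrad_cst R 1; have h0 := @hasgrad_cst R 0.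
have HP := hasgrad_cform (bspin_gt0 L) hp hq hx hy hpx hqx h1 h0.
have HQ := hasgrad_cform (bspin_gt0 L) hp hq hx hy hpy hqy h0 h1.
do 4 eexists; split; [exact: HP|exact: HQ|].
by move=> z; rewrite btripleE// cformD_curl.
Qed.

Lemma bP_outer z : 1 <= rsq z ->
  bP z = - (2 * z.2 * (2 * rsq z - 2 * dlt L + 1)) / bspin L z.
Proof.
move=> s1; have [] := @phi_outer _ _ L1 z.
  by apply: le_trans s1 _; rewrite lerDl sqr_ge0.
rewrite /bP /cform /bspin mulrC /pre_x /pim_x /pre /pim => -> ->.
by congr (_ / _); rewrite /rsq; ring.
Qed.

Lemma bQ_outer z : 1 <= rsq z ->
  bQ z = (2 * z.1 * (2 * rsq z + 2 * dlt L + 1)) / bspin L z.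
Proof.
move=> s1; have [] := @phi_outer _ _ L1 z.
  by apply: le_trans s1 _; rewrite lerDl sqr_ge0.
rewrite /bQ /cform /bspin mulrC /pre_y /pim_y /pre /pim => -> ->.
by congr (_ / _); rewrite /rsq; ring.
Qed.

Lemma bspin_outer z : 1 <= rsq z ->
  bspin L z = rsq z ^+ 2 + 2 * dlt L * (z.1 ^+ 2 - z.2 ^+ 2) + dlt L ^+ 2 + rsq z.
Proof.
move=> s1; have [] := @phi_outer _ _ L1 z.
  by apply: le_trans s1 _; rewrite lerDl sqr_ge0.
by rewrite /bspin /spin /pre /pim => -> _; rewrite /rsq; ring.
Qed.

(** Far away the map is like z^2, whose connection form is 4 dtheta; this is the leading term 4 /
    |z|^2. The sign [e] is 1 for [bQ] on vertical sides and - 1 for [bP] on horizontal ones. *)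
Lemma outer_ratio_bound T z (e : R) : 2 <= T -> T ^+ 2 <= rsq z ->
  (e = 1) \/ (e = - 1) ->
  `|2 * (2 * rsq z + e * 2 * dlt L + 1) / bspin L z - 4 / rsq z| <= 20 / T ^+ 4.
Proof.
move=> T2 sT he.
have T2' : 4 <= T ^+ 2 by nra.
have s1 : 1 <= rsq z by lra.
have d0 := dlt_gt0 L; have dh := dlt_half L1.
have xy : `|z.1 ^+ 2 - z.2 ^+ 2| <= rsq z.
  by rewrite ler_norml /rsq; have := sqr_ge0 z.1; have := sqr_ge0 z.2; lra.
have Ns : rsq z ^+ 2 <= bspin L z.
  rewrite bspin_outer//; move: xy; rewrite ler_norml => /andP[xy _]; nra.
have s0 : 0 < rsq z by lra.
have N0 : 0 < bspin L z by apply: lt_le_trans Ns; rewrite exprn_gt0.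
have -> : 2 * (2 * rsq z + e * 2 * dlt L + 1) / bspin L z - 4 / rsq z =
  2 * ((2 * rsq z + e * 2 * dlt L + 1) * rsq z - 2 * bspin L z) / (rsq z * bspin L z).
  by field; rewrite !gt_eqF.
have num : `|2 * ((2 * rsq z + e * 2 * dlt L + 1) * rsq z - 2 * bspin L z)| <= 20 * rsq z.
  rewrite bspin_outer//; move: xy; rewrite !ler_norml => /andP[xy1 xy2].
  have dd : dlt L ^+ 2 <= 1 by nra.
  have dxy1 : dlt L * (z.1 ^+ 2 - z.2 ^+ 2) <= 2^-1 * rsq z by nra.
  have dxy2 : - (2^-1 * rsq z) <= dlt L * (z.1 ^+ 2 - z.2 ^+ 2) by nra.
  have ds : dlt L * rsq z <= 2^-1 * rsq z by nra.
  have ds0 : 0 <= dlt L * rsq z by rewrite mulr_ge0 ?ltW.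
  by case: he => ->; apply/andP; split; nra.
rewrite normrM normfV (gtr0_norm (mulr_gt0 s0 N0)).
rewrite ler_pdivrMr ?mulr_gt0//; apply: le_trans num _.
rewrite -mulrA ler_wpM2l//.
rewrite ler_pdivlMl ?exprn_gt0//; last by lra.
rewrite mulrC ler_wpM2l ?(ltW s0)//; apply: le_trans Ns.
have -> : T ^+ 4 = (T ^+ 2) ^+ 2 by rewrite -exprM.
by rewrite ler_sqr ?nnegrE ?sqr_ge0// ltW.
Qed.

End BubbleEnergy.

(** * Flux of the connection form through large squares *)

Section BubbleEnergyTotal.
Local Open Scope classical_set_scope.
Context {R : realType} (L : R) (L1 : 1 <= L).
Implicit Types (z : R * R) (T : R).

Local Notation mu := (@lebesgue_measure R).
Local Notation mu2 := (mu \x mu)%E.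

Lemma boundary_integral (G : R -> R) T : 2 <= T -> continuous G ->
  (forall y, - T <= y <= T -> `|G y - 8 * T / (T ^+ 2 + y ^+ 2)| <= 40 / T ^+ 3) ->
  exists2 I : R, (\int[mu]_(y in `[(- T)%R, T]) (G y)%:E)%E = I%:E &
    `|I - 4 * pi| <= 80 / T ^+ 2.
Proof.
move=> T2 cG HG; have T0 : 0 < T by lra.
exists (Rintegral mu `[- T, T] G).
  rewrite /Rintegral fineK//; apply: integrable_fin_num => //.
  exact: continuous_integrable_itv.
rewrite -(Rintegral_poisson T0).
apply: le_trans (Rintegral_sup_dist _ cG (continuous_poisson T0) HG) _.
  by lra.
rewrite le_eqVlt; apply/orP; left; apply/eqP; field; lra.
Qed.

(** By Green's formula the area integral is a flux: each pair of sides of length 2 T gives 4 pi with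
    an error 2 T * 40 / T^3. *)
Lemma btriple_sq T : 2 <= T -> exists2 I : R,
  (\int[mu2]_(z in sq T) (btriple L z)%:E)%E = I%:E & `|I - 8 * pi| <= 160 / T ^+ 2.
Proof.
move=> T2; have T0 : 0 < T by lra.
have [Px [Py [Qx [Qy [hP hQ bE]]]]] := green_btriple L1.
have cP : continuous (bP L) by have [_ _ _ [[]]] := hP.
have cQ : continuous (bQ L) by have [_ _ _ [[]]] := hQ.
have rT (a b : R) : a ^+ 2 = T ^+ 2 -> T ^+ 2 <= rsq (a, b) /\ T ^+ 2 <= rsq (b, a).
  by rewrite /rsq/= => ->; rewrite lerDl lerDr sqr_ge0.
have T21 : 1 <= T ^+ 2 by nra.
(* Opposite sides contribute equally, whence the factor 2 T in front of the ratio of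
   [outer_ratio_bound]. *)
have flux (k : R) : `|k| <= 20 / T ^+ 4 -> `|2 * T * k| <= 40 / T ^+ 3.
  move=> hk; rewrite normrM (gtr0_norm (x := 2 * T)) ?mulr_gt0//.
  apply: le_trans (ler_wpM2l _ hk) _; first by rewrite mulr_ge0// ltW.
  by rewrite le_eqVlt; apply/orP; left; apply/eqP; field; lra.
have [I hI bI] : exists2 I : R, (\int[mu]_(y in `[(- T)%R, T])
    (bQ L (T, y) - bQ L (- T, y))%:E)%E = I%:E & `|I - 4 * pi| <= 80 / T ^+ 2.
  apply: boundary_integral => //.
    by move=> y; apply: cvgB; exact: (continuous_line2 cQ).
  move=> y _; have [s1 _] := rT T y erefl.
  have [s2 _] := rT (- T) y (sqrrN _).
  rewrite !(bQ_outer L1) ?(le_trans T21)//.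
  have Es : rsq (- T, y) = rsq (T, y) by rewrite /rsq/= sqrrN.
  have EN : bspin L (- T, y) = bspin L (T, y).
    rewrite (@bspin_outer _ _ L1 (- T, y)) ?(le_trans T21)//.
    by rewrite (@bspin_outer _ _ L1 (T, y)) ?(le_trans T21)// Es /= sqrrN.
  rewrite Es EN /=.
  have := @outer_ratio_bound _ _ L1 T (T, y) 1 T2 s1 (or_introl erefl).
  move/flux; apply: le_trans; rewrite le_eqVlt; apply/orP; left; apply/eqP.
  congr (`|_|); rewrite -[T ^+ 2 + y ^+ 2]/(rsq (T, y)); ring.
have [J hJ bJ] : exists2 J : R, (\int[mu]_(x in `[(- T)%R, T])
    (bP L (x, T) - bP L (x, - T))%:E)%E = J%:E & `|J + 4 * pi| <= 80 / T ^+ 2.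
  (* The sign is reversed because the difference of [bP] across the horizontal sides has integral
     close to - 4 pi. *)
  have [] := @boundary_integral (fun x => bP L (x, - T) - bP L (x, T)) T T2.
  - by move=> x; apply: cvgB; exact: (continuous_line1 cP).
  - move=> x _; have [_ s1] := rT T x erefl.
    have [_ s2] := rT (- T) x (sqrrN _).
    rewrite !(bP_outer L1) ?(le_trans T21)//.
    have Es : rsq (x, - T) = rsq (x, T) by rewrite /rsq/= sqrrN.
    have EN : bspin L (x, - T) = bspin L (x, T).
      rewrite (@bspin_outer _ _ L1 (x, - T)) ?(le_trans T21)//.
      by rewrite (@bspin_outer _ _ L1 (x, T)) ?(le_trans T21)// Es /= sqrrN.
    rewrite Es EN /=.
    have := @outer_ratio_bound _ _ L1 T (x, T) (- 1) T2 s1 (or_intror erefl).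
    move/flux; apply: le_trans; rewrite le_eqVlt; apply/orP; left; apply/eqP.
    have -> : T ^+ 2 + x ^+ 2 = rsq (x, T) by rewrite /rsq/= addrC.
    congr (`|_|); ring.
  move=> J hJ bJ; exists (- J); last by rewrite addrC distrC.
  rewrite EFinN -hJ -integralN/=; last first.
    have cD : continuous (fun x => bP L (x, - T) - bP L (x, T)).
      by move=> x; apply: cvgB; exact: (continuous_line1 cP).
    exact: integrable_add_def (continuous_integrable_itv (- T) T cD).
  by apply: eq_integral => x _ /=; congr EFin; rewrite opprB.
exists (I - J); last by move: bI bJ; rewrite !ler_norml => /andP[? ?] /andP[? ?]; lra.
have [_ _ _ [_ cQx _]] := hQ; have [_ _ _ [_ _ cPy]] := hP.
rewrite EFinB -hI -hJ -(green_x T0 hQ) -(green_y T0 hP).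
rewrite -integralB_EFin; [|exact: measurable_sq|exact: integrable_sq|exact: integrable_sq].
by apply: eq_integral => z _; rewrite bE EFinB.
Qed.

End BubbleEnergyTotal.

(** * The energy excess is O(1/L) *)

Section BubbleTotals.
Local Open Scope classical_set_scope.
Context {R : realType} (L : R) (L1 : 1 <= L).
Implicit Types (z : R * R) (T : R).

Local Notation mu := (@lebesgue_measure R).
Local Notation mu2 := (mu \x mu)%E.

Lemma contm_defect : contm (defect L).
Proof.
have [_ _ _ [cm _ _]] := hasgrad_phm L1.
have [_ _ _ [cr _ _]] := @hasgrad_rsq R.
have [_ _ _ [cs _ _]] := hasgrad_spin (hasgrad_pre L) (hasgrad_pim L) (@hasgrad_fst R) (@hasgrad_snd R).
have cV := contmV (bspin_gt0 L) cs.
apply: contmM; last exact: contmX.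
apply: contmM; last exact: contmX.
by apply: contmM; [exact: contm_cst|exact: contmX].
Qed.

Lemma contm_btriple : contm (btriple L).
Proof.
have [Px [Py [Qx [Qy [hP hQ bE]]]]] := green_btriple L1.
have [_ _ _ [_ cQx _]] := hQ; have [_ _ _ [_ _ cPy]] := hP.
rewrite (_ : btriple L = fun z => Qx z - Py z); last exact/funext.
exact: contmB.
Qed.

Lemma defect_out z : ~ sq 1 z -> defect L z = 0.
Proof.
case: z => x y zout; have s1 : 1 <= rsq (x, y).
  rewrite /rsq/= leNgt; apply/negP => s1; apply: zout.
  have unit_itv (a : R) : a ^+ 2 <= 1 -> - 1 <= a <= 1.
    by move=> a1; apply/andP; split; nra.
  by split; rewrite /= in_itv/=; apply: unit_itv; have := sqr_ge0 x;
    have := sqr_ge0 y; lra.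
have [] := @phi_outer _ _ L1 (x, y).
  by apply: le_trans s1 _; rewrite lerDl sqr_ge0.
by rewrite /defect => _ ->; rewrite expr0n/= mulr0 !mul0r.
Qed.

Lemma psi_ge z : 0 <= psi L z + 2 * L.
Proof.
have : ln (dlt L ^+ 2) <= psi L z.
  by rewrite ler_ln ?posrE ?Sd_gt0 ?exprn_gt0 ?dlt_gt0// lerDr rsq_ge0.
rewrite lnXn ?dlt_gt0// /dlt expRK mulr2n; lra.
Qed.

(** [Sd] is at most 2 + 1/4 on the square, and ln s < s. *)
Lemma psi_le z : sq 1 z -> psi L z <= 3.
Proof.
case: z => x y [/=]; rewrite !in_itv/= => /andP[x1 x2] /andP[y1 y2].
apply/ltW/(lt_le_trans (ln_sublinear (Sd_gt0 L _))).
by rewrite /Sd /rsq/=; have := dlt_half L1; have := dlt_gt0 L; nra.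
Qed.

(* Integrating the divergence of (psi + 2 L) grad psi bounds the Dirichlet
   integral of psi by a boundary term, psi being subharmonic. *)
Definition field1 z : R := (psi L z + 2 * L) * ((Sd L z)^-1 * (2 * z.1)).
Definition field2 z : R := (psi L z + 2 * L) * ((Sd L z)^-1 * (2 * z.2)).

(** The divergence is |grad psi|^2 plus a nonnegative term, where |grad psi|^2 = 4 |z|^2 / [Sd]^2.
    With |z|^4 <= [bspin]^2 and the bound 81 of [cutoff1_sqr_le], the defect is at most 8 * 81 / 4 =
    162 times |grad psi|^2 / L^2. *)
Lemma green_field : exists f1x f1y f2x f2y,
  [/\ hasgrad field1 f1x f1y, hasgrad field2 f2x f2y &
   forall z, defect L z <= 162 / L ^+ 2 * (f1x z + f2y z)].
Proof.
have hS := hasgradV (Sd_gt0 L) (hasgrad_Sd L).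
have hp := hasgradD (hasgrad_psi L) (hasgrad_cst (2 * L)).
have h2 := @hasgrad_cst R 2.
have h1 := hasgradM hp (hasgradM hS (hasgradM h2 (@hasgrad_fst R))).
have h3 := hasgradM hp (hasgradM hS (hasgradM h2 (@hasgrad_snd R))).
do 4 eexists; split; [exact: h1|exact: h3|move=> z /=].
have S0 := Sd_gt0 L z; have N0 := bspin_gt0 L z; have L0 := L_gt0 L1.
have s0 := rsq_ge0 z; have sN := rsq_le_bspin L z.
apply: (@le_trans _ _ (162 / L ^+ 2 * (4 * rsq z * (Sd L z)^-1 ^+ 2))); last first.
  rewrite ler_wpM2l ?divr_ge0 ?sqr_ge0// -subr_ge0.
  set X := (X in 0 <= X).
  (* The rest of the divergence is psi + 2 L times the laplacian of psi. *)
  suff -> : X = (psi L z + 2 * L) * (4 * dlt L ^+ 2 * (Sd L z)^-1 ^+ 2).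
    by do 2![rewrite mulr_ge0 ?psi_ge ?sqr_ge0//]; rewrite mulr_ge0 ?sqr_ge0.
  have E : dlt L ^+ 2 = Sd L z - z.1 ^+ 2 - z.2 ^+ 2 by rewrite /Sd /rsq; ring.
  by rewrite /X E /rsq; field; rewrite gt_eqF.
have sN1 : rsq z ^+ 2 * (bspin L z)^-1 ^+ 2 <= 1.
  have q0 : 0 <= rsq z / bspin L z by rewrite divr_ge0// ltW.
  have q1 : rsq z / bspin L z <= 1 by rewrite ler_pdivrMr ?mul1r.
  by rewrite -exprMn; exact: exprn_ile1.
rewrite /defect.
have -> : 8 * phm L z ^+ 2 * rsq z ^+ 3 * (bspin L z)^-1 ^+ 2 =
  8 * phm L z ^+ 2 * rsq z * (rsq z ^+ 2 * (bspin L z)^-1 ^+ 2) by ring.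
apply: (@le_trans _ _ (8 * phm L z ^+ 2 * rsq z)).
  by rewrite ler_piMr// mulr_ge0// mulr_ge0// sqr_ge0.
have -> : 162 / L ^+ 2 * (4 * rsq z * (Sd L z)^-1 ^+ 2) =
  8 * (81 * (L * Sd L z)^-1 ^+ 2) * rsq z.
  by field; rewrite !gt_eqF.
rewrite ler_wpM2r// ler_wpM2l// /phm exprMn ler_wpM2r ?sqr_ge0//.
exact: cutoff1_sqr_le.
Qed.

Lemma flux_abs_le (G : R -> R) (c : R) : continuous G ->
  (forall y, - 1 <= y <= 1 -> `|G y| <= c) ->
  exists2 I : R, (\int[mu]_(y in `[(- 1)%R, 1%R]) (G y)%:E)%E = I%:E & I <= 2 * c.
Proof.
move=> cG HG; exists (Rintegral mu `[- 1, 1] G).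
  rewrite /Rintegral fineK//; apply: integrable_fin_num => //.
  exact: continuous_integrable_itv.
have c0 : continuous (fun _ : R => 0 : R) by exact: cst_continuous.
have := @Rintegral_sup_dist R G (fun=> 0) (- 1) 1 c _ cG c0.
rewrite Rintegral_cst//= mul0r subr0 => H.
apply: le_trans (ler_norm _) _; apply: le_trans (H _ _) _.
- lra.
- by move=> y /HG; rewrite subr0.
- lra.
Qed.

(** On the boundary each field is at most (3 + 2 L) * 2 <= 10 L, so each pair of sides of length 2
    gives at most 40 L; finally 12960 = 162 * 80. *)
Lemma defect_sq_le : exists2 D : R,
  (\int[mu2]_(z in sq 1) (defect L z)%:E)%E = D%:E & D <= 12960 / L.
Proof.
have [f1x [f1y [f2x [f2y [h1 h2 H]]]]] := green_field.
have c1 : continuous field1 by have [_ _ _ [[]]] := h1.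
have c2 : continuous field2 by have [_ _ _ [[]]] := h2.
have [_ _ _ [_ c1x _]] := h1; have [_ _ _ [_ _ c2y]] := h2.
have one0 : 0 < 1 :> R by [].
have S1 (a b : R) : a ^+ 2 = 1 -> 1 <= Sd L (a, b) /\ 1 <= Sd L (b, a).
  move=> a1; rewrite /Sd /rsq/= a1.
  by have := sqr_ge0 b; have := sqr_ge0 (dlt L); lra.
have bnd z (k : R) : sq 1 z -> 1 <= Sd L z -> `|k| <= 1 ->
    `|(psi L z + 2 * L) * ((Sd L z)^-1 * (2 * k))| <= 10 * L.
  move=> z1 Sz k1; have p0 := psi_ge z; have p1 := psi_le z1.
  have S0 := Sd_gt0 L z.
  rewrite !normrM normfV (gtr0_norm S0) (ger0_norm p0) (ger0_norm (x := 2))//.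
  have i1 : (Sd L z)^-1 <= 1 by rewrite invf_le1.
  have i0 : 0 <= (Sd L z)^-1 by rewrite invr_ge0 ltW.
  have k2 : 2 * `|k| <= 2 by rewrite ler_piMr.
  have k0 : 0 <= 2 * `|k| by rewrite mulr_ge0.
  have -> : 10 * L = 5 * L * (1 * 2) by ring.
  apply: ler_pM => //; [by rewrite mulr_ge0|by have := L1; lra|exact: ler_pM].
have [I hI bI] : exists2 I : R, (\int[mu]_(y in `[(- 1)%R, 1%R])
    (field1 (1, y) - field1 (- 1, y))%:E)%E = I%:E & I <= 2 * (20 * L).
  apply: flux_abs_le.
    by move=> y; apply: cvgB; exact: (continuous_line2 c1).
  move=> y y1; apply: le_trans (ler_normB _ _) _.
  have -> : 20 * L = 10 * L + 10 * L by ring.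
  apply: lerD; apply: bnd.
  - by split; rewrite /= in_itv//= lexx gt0_cp.
  - by have [] := S1 1 y (expr1n _ _).
  - by rewrite normr1.
  - by split; rewrite /= in_itv//= lexx gt0_cp.
  - by have [] := S1 (- 1) y (etrans (sqrrN _) (expr1n _ _)).
  - by rewrite normrN1.
have [J hJ bJ] : exists2 J : R, (\int[mu]_(x in `[(- 1)%R, 1%R])
    (field2 (x, 1) - field2 (x, - 1))%:E)%E = J%:E & J <= 2 * (20 * L).
  apply: flux_abs_le.
    by move=> y; apply: cvgB; exact: (continuous_line1 c2).
  move=> y y1; apply: le_trans (ler_normB _ _) _.
  have -> : 20 * L = 10 * L + 10 * L by ring.
  apply: lerD; apply: bnd.
  - by split; rewrite /= in_itv//= lexx gt0_cp.
  - by have [] := S1 1 y (expr1n _ _).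
  - by rewrite normr1.
  - by split; rewrite /= in_itv//= lexx gt0_cp.
  - by have [] := S1 (- 1) y (etrans (sqrrN _) (expr1n _ _)).
  - by rewrite normrN1.
have i1 := integrable_sq 1 c1x; have i2 := integrable_sq 1 c2y.
have iD := integrable_sq 1 contm_defect.
have mS := measurable_sq (1 : R).
have L0 := L_gt0 L1.
exists (Rintegral mu2 (sq 1) (defect L)).
  by rewrite /Rintegral fineK//; apply: integrable_fin_num.
have cs := contmD c1x c2y.
have cb : contm (fun z => 162 / L ^+ 2 * (f1x z + f2y z)).
  by apply: contmM => //; exact: contm_cst.
apply: le_trans (le_Rintegral mS iD (integrable_sq 1 cb) (fun z _ => H z)) _.
rewrite RintegralZl//; last exact: integrable_sq.
rewrite RintegralD// {1 2}/Rintegral (green_x one0 h1) (green_y one0 h2) hI hJ /=.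
apply: (@le_trans _ _ (162 / L ^+ 2 * (80 * L))).
  by rewrite ler_wpM2l ?divr_ge0 ?sqr_ge0//; lra.
by rewrite le_eqVlt; apply/orP; left; apply/eqP; field; rewrite gt_eqF.
Qed.

End BubbleTotals.

(** * Total energy and degree *)

Section BubbleDegree.
Local Open Scope classical_set_scope.
Context {R : realType} (L : R) (L1 : 1 <= L).
Implicit Types (z : R * R) (T : R).

Local Notation mu := (@lebesgue_measure R).
Local Notation mu2 := (mu \x mu)%E.

Lemma defect_mkcond T : 1 <= T -> (fun z => (defect L z)%:E) \_ (sq T) = EFin \o defect L.
Proof.
move=> T1; apply/funext => z; rewrite patchE; case: ifPn => // /negP zT.
rewrite /= defect_out// => z1; apply: zT; rewrite inE.
move: z1; rewrite /sq /= !in_itv/= => -[/andP[a b] /andP[c d]].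
by split; apply/andP; split; lra.
Qed.

Lemma gradsq_bub_sq T (D : R) : 2 <= T ->
  (\int[mu2]_(z in sq 1) (defect L z)%:E)%E = D%:E ->
  exists2 I : R, (\int[mu2]_(z in sq T) (gradsq (bub L) z)%:E)%E = (2 * I + 2 * D)%:E &
    `|I - 8 * pi| <= 160 / T ^+ 2.
Proof.
move=> T2 hD; have [I hI bI] := btriple_sq L1 T2; exists I => //.
have mT := measurable_sq T.
have ct := contm_btriple L1; have cd := contm_defect L1.
have c2 := @contm_cst R 2.
transitivity (\int[mu2]_(z in sq T) ((2 * btriple L z)%:E + (2 * defect L z)%:E))%E.
  apply: eq_integral => z _; rewrite -EFinD; congr EFin.
  by rewrite -mulrDr -(gradsq_bub L); field.
have Z (f : R * R -> R) : contm f -> (\int[mu2]_(z in sq T) (2 * f z)%:E =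
    2%:E * \int[mu2]_(z in sq T) (f z)%:E)%E.
  move=> cf; rewrite -integralZl//; last exact: integrable_sq.
transitivity (\int[mu2]_(z in sq T) (2 * btriple L z)%:E +
              \int[mu2]_(z in sq T) (2 * defect L z)%:E)%E.
  by apply: integralD_EFin => //; apply: integrable_sq; exact: contmM.
rewrite !Z// hI integral_mkcond defect_mkcond; last by lra.
by rewrite -(defect_mkcond (lexx 1)) -integral_mkcond hD -!EFinM -EFinD.
Qed.

Lemma contm_gradsq_bub : contm (gradsq (bub L)).
Proof.
rewrite (_ : gradsq (bub L) = fun z => 2 * (btriple L z + defect L z)).
  apply: contmM; first exact: contm_cst.
  by apply: contmD; [exact: contm_btriple|exact: contm_defect].
by apply/funext => z; rewrite -(gradsq_bub L); field.
Qed.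

Lemma gradsq_ge0 (f : R * R -> 'rV[R]_3) z : 0 <= gradsq f z.
Proof. by apply: sumr_ge0 => i _; rewrite addr_ge0 ?sqr_ge0. Qed.

(** The exhaustion starts at side parameter 2, as [btriple_sq] requires. *)
Lemma bigcup_sq : \bigcup_n sq (n.+2%:R : R) = [set: R * R].
Proof.
rewrite -subTset => -[x y] _.
have m0 : 0 <= Num.max `|x| `|y| by rewrite le_max normr_ge0.
have := archi_boundP m0; set n := Num.bound _; rewrite gt_max => /andP[xn yn].
have n2 : n%:R <= n.+2%:R :> R by rewrite ler_nat -addn2 leq_addr.
by exists n => //; rewrite /sq/= !in_itv/= -!ler_norml; split; lra.
Qed.

(** The area density is not known to have a sign, so monotone convergence along the squares is
    applied to the nonnegative density [gradsq], twice the area density plus twice the defect. *)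
Lemma gradsq_bub_integral (D : R) :
  (\int[mu2]_(z in sq 1) (defect L z)%:E)%E = D%:E ->
  (\int[mu2]_z (gradsq (bub L) z)%:E)%E = (16 * pi + 2 * D)%:E.
Proof.
move=> hD; have [_ mg] := contm_gradsq_bub.
have nd : nondecreasing_seq (fun n => sq (n.+2%:R : R)).
  move=> m n mn; apply/subsetPset => -[x y]; rewrite /sq/= !in_itv/=.
  have : m.+2%:R <= n.+2%:R :> R by rewrite ler_nat.
  by move=> ? [/andP[? ?] /andP[? ?]]; split; apply/andP; split; lra.
have mF n : measurable (sq (n.+2%:R : R)) by exact: measurable_sq.
have cv1 := @ge0_nondecreasing_set_cvg_integral _ _ R (fun n => sq (n.+2%:R : R))
  (fun z => (gradsq (bub L) z)%:E) mu2 nd mF.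
rewrite bigcup_sq in cv1.
have {}cv1 := cv1 (fun n => measurable_funTS ((measurable_EFinP _ _).2 mg))
   (fun n z _ => gradsq_ge0 _ z).
have T2 n : 2 <= (n.+2%:R : R) by rewrite ler_nat.
pose I n : R := sval (cid2 (gradsq_bub_sq (T2 n) hD)).
have HI n : (\int[mu2]_(z in sq n.+2%:R) (gradsq (bub L) z)%:E)%E = (2 * I n + 2 * D)%:E.
  by rewrite /I; case: cid2.
have bI n : `|I n - 8 * pi| <= 160 / n.+2%:R ^+ 2 by rewrite /I; case: cid2.
apply: (cvg_unique _ cv1) => //.
suff : ((2 * I n + 2 * D)%:E @[n --> \oo] --> (16 * pi + 2 * D)%:E)%classic.
  by apply: cvg_trans; apply: near_eq_cvg; apply: nearW => n; rewrite HI.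
apply: cvg_EFin; first by apply: nearW.
have cI : (I n @[n --> \oo] --> 8 * pi)%classic.
  have h0 := @cvg_harmonic R.
  have hk (k : R) : (8 * pi + k * harmonic n @[n --> \oo] --> 8 * pi)%classic.
    rewrite -[X in _ --> X]addr0 -(mulr0 k).
    by apply: cvgD; [exact: cvg_cst|apply: cvgM => //; exact: cvg_cst].
  apply: squeeze_cvgr (hk (- 160)) (hk 160); apply: nearW => n.
  rewrite /harmonic/=.
  have : 160 / n.+2%:R ^+ 2 <= 160 * n.+1%:R^-1 :> R.
    rewrite ler_wpM2l// lef_pV2 ?posrE ?exprn_gt0//.
    by rewrite -natrX ler_nat; nia.
  rewrite mulNr; have := bI n; rewrite ler_norml.
  move: (160 / n.+2%:R ^+ 2) (160 * n.+1%:R^-1) (I n) => a b c /andP[? ?] ?.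
  by apply/andP; split; lra.
have -> : 16 * pi + 2 * D = 2 * (8 * pi) + 2 * D by ring.
by apply: cvgD; [apply: cvgM => //; exact: cvg_cst|exact: cvg_cst].
Qed.

(** Once [gradsq] and the defect are integrable, so is the area density; its integral is (8 pi + D)
    - D, exactly 4 pi times 2. *)
Lemma bub_energy_degree (D : R) :
  (\int[mu2]_(z in sq 1) (defect L z)%:E)%E = D%:E ->
  [/\ finite_dirichlet (bub L), energy (bub L) = 8 * pi + D & degree (bub L) = 2].
Proof.
move=> hD; have hg := gradsq_bub_integral hD.
have [_ mg] := contm_gradsq_bub.
have hE : Rintegral (leb2 R) setT (gradsq (bub L)) = 16 * pi + 2 * D.
  by rewrite /Rintegral /leb2 hg.
have ig : mu2.-integrable setT (EFin \o gradsq (bub L)).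
  apply/integrableP; split; first exact/measurable_EFinP.
  suff -> : (\int[mu2]_z `|(EFin \o gradsq (bub L)) z|)%E = (16 * pi + 2 * D)%:E by rewrite ltry.
  rewrite -hg; apply: eq_integral => z _.
  by rewrite /= ger0_norm// gradsq_ge0.
have hDT : (\int[mu2]_z (defect L z)%:E)%E = D%:E.
  by rewrite -hD [RHS]integral_mkcond defect_mkcond.
have id : mu2.-integrable setT (EFin \o defect L).
  rewrite -(defect_mkcond (lexx 1)); apply/(integrable_mkcond _ (measurable_sq 1)).
  exact: integrable_sq (contm_defect L1).
split.
- by rewrite /finite_dirichlet /leb2 hg ltry.
- by rewrite /energy hE; field.
- have ig2 : mu2.-integrable setT (EFin \o (fun z => 2^-1 * gradsq (bub L) z)).
    exact: (integrableZl measurableT (2^-1) ig).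
  rewrite /degree /leb2.
  have -> : Rintegral mu2 setT (fun z => triple (bub L z) (dy (bub L) z) (dx (bub L) z)) =
      Rintegral mu2 setT (fun z => 2^-1 * gradsq (bub L) z - defect L z).
    by apply: eq_Rintegral => z _; rewrite (gradsq_bub L) addrK.
  have hE2 : Rintegral mu2 setT (gradsq (bub L)) = 16 * pi + 2 * D := hE.
  have hD2 : Rintegral mu2 setT (defect L) = D by rewrite /Rintegral hDT.
  rewrite RintegralB// RintegralZl// hE2 hD2.
  by move: (pi_gt0 R); move: (pi : R) => p p0; field; rewrite gt_eqF.
Qed.

End BubbleDegree.

(** * Interpolation of complex cubics *)

Section ComplexNorm.
Context {R : realType}.
Implicit Types x y z : R[i].

(** The modulus with values in [R] rather than in [R[i]], so that real linear arithmetic applies. *)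
Definition cn z : R := Normc.normc z.

Lemma cn_ge0 z : 0 <= cn z. Proof. by case: z => a b; rewrite /cn/= sqrtr_ge0. Qed.

Lemma cn_sqr z : cn z ^+ 2 = complex.Re z ^+ 2 + complex.Im z ^+ 2.
Proof. by case: z => a b; rewrite /cn/= sqr_sqrtr// addr_ge0 ?sqr_ge0. Qed.

Lemma cnM x y : cn (x * y) = cn x * cn y. Proof. exact: Normc.normcM. Qed.

Lemma cnN x : cn (- x) = cn x. Proof. exact: normcN. Qed.

Lemma cnD x y : cn (x + y) <= cn x + cn y. Proof. exact: le_normcD. Qed.

Lemma cnB x y : cn (x - y) <= cn x + cn y.
Proof. by rewrite -(cnN y); exact: cnD. Qed.

Lemma cn_sub x y : cn x <= cn y + cn (x - y).
Proof. by have := cnD y (x - y); rewrite addrC subrK. Qed.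

Lemma cn0 : cn (0 : R[i]) = 0. Proof. exact: Normc.normc0. Qed.

Lemma cn1 : cn (1 : R[i]) = 1. Proof. exact: Normc.normc1. Qed.

Lemma cnX x n : cn (x ^+ n) = cn x ^+ n.
Proof. by elim: n => [|n IHn]; rewrite ?cn1 // !exprS cnM IHn. Qed.

Lemma cn_real (r : R) : 0 <= r -> cn (r%:C)%C = r.
Proof. by move=> r0; rewrite /cn/= expr0n/= addr0 sqrtr_sqr ger0_norm. Qed.

Lemma cn_gt0 x : x != 0 -> 0 < cn x.
Proof.
move=> x0; rewrite lt0r cn_ge0 andbT; apply: contra x0 => /eqP h.
by apply/eqP; exact: Normc.eq0_normc.
Qed.

Definition cubic (c : R[i] * R[i] * R[i] * R[i]) z : R[i] :=
  let: (c0, c1, c2, c3) := c in c0 + c1 * z + c2 * z ^+ 2 + c3 * z ^+ 3.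

(* Newton's divided differences. *)
Lemma cubic_coef_bound c0 c1 c2 c3 z0 z1 z2 z3 (e : R) :
  [/\ cn z0 <= 8, cn z1 <= 8, cn z2 <= 8 & cn z3 <= 8] ->
  [/\ 1 <= cn (z1 - z0), 1 <= cn (z2 - z1) & 1 <= cn (z3 - z2)] ->
  [/\ 1 <= cn (z2 - z0), 1 <= cn (z3 - z1) & 1 <= cn (z3 - z0)] ->
  let c := cubic (c0, c1, c2, c3) in
  [/\ cn (c z0) <= e, cn (c z1) <= e, cn (c z2) <= e & cn (c z3) <= e] ->
  [/\ cn c0 <= 100 * (1000 * e), cn c1 <= 100 * (1000 * e), cn c2 <= 100 * (1000 * e) & cn c3 <= 100 * (1000 * e)].
Proof.
move=> [b0 b1 b2 b3] [d10 d21 d32] [d20 d31 d30] c [e0 e1 e2 e3].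
have step (d f g h : R[i]) (a b : R) : d * f = g - h -> 1 <= cn d ->
    cn g <= a -> cn h <= b -> cn f <= a + b.
  move=> E d1 ga hb; apply: (@le_trans _ _ (cn (g - h))).
    by rewrite -E cnM ler_peMl// cn_ge0.
  by apply: le_trans (cnB _ _) _; exact: lerD.
(* First and second divided differences; [step] divides by differences of modulus at least 1, so
   orders 1, 2, 3 are bounded by 2 e, 4 e, 8 e. *)
pose f (z w : R[i]) := c1 + c2 * (z + w) + c3 * (z ^+ 2 + z * w + w ^+ 2).
pose g (z w v : R[i]) := c2 + c3 * (z + w + v).
have F z w : (w - z) * f z w = c w - c z by rewrite /f /c /cubic; ring.
have G z w v : (v - z) * g z w v = f w v - f z w by rewrite /f /g; ring.
have H : (z3 - z0) * c3 = g z1 z2 z3 - g z0 z1 z2 by rewrite /g; ring.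
have f01 := step _ _ _ _ _ _ (F z0 z1) d10 e1 e0.
have f12 := step _ _ _ _ _ _ (F z1 z2) d21 e2 e1.
have f23 := step _ _ _ _ _ _ (F z2 z3) d32 e3 e2.
have g012 := step _ _ _ _ _ _ (G z0 z1 z2) d20 f12 f01.
have g123 := step _ _ _ _ _ _ (G z1 z2 z3) d31 f23 f12.
have h3 := step _ _ _ _ _ _ H d30 g123 g012.
have e_0 : 0 <= e := le_trans (cn_ge0 _) e0.
have mulb x y (a b : R) : cn x <= a -> cn y <= b -> cn (x * y) <= a * b.
  by move=> xa yb; rewrite cnM ler_pM// cn_ge0.
(* The lower coefficients follow in descending order from nodes of modulus at most 8; here 196 = 4 +
   8 * 24. *)
have h2 : cn c2 <= 196 * e.
  have -> : c2 = g z0 z1 z2 - c3 * (z0 + z1 + z2) by rewrite /g; ring.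
  have s : cn (z0 + z1 + z2) <= 24.
    by have := cnD (z0 + z1) z2; have := cnD z0 z1; lra.
  by have := cnB (g z0 z1 z2) (c3 * (z0 + z1 + z2)); have := mulb _ _ _ _ h3 s; lra.
have h1 : cn c1 <= 5 * (1000 * e).
  have -> : c1 = f z0 z1 - (c2 * (z0 + z1) + c3 * (z0 ^+ 2 + z0 * z1 + z1 ^+ 2)).
    by rewrite /f; ring.
  have s1 : cn (z0 + z1) <= 16 by have := cnD z0 z1; lra.
  have s2 : cn (z0 ^+ 2 + z0 * z1 + z1 ^+ 2) <= 192.
    have := cnD (z0 ^+ 2 + z0 * z1) (z1 ^+ 2); have := cnD (z0 ^+ 2) (z0 * z1).
    by have := mulb _ _ _ _ b0 b0; have := mulb _ _ _ _ b0 b1;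
       have := mulb _ _ _ _ b1 b1; rewrite -!expr2; lra.
  have := cnB (f z0 z1) (c2 * (z0 + z1) + c3 * (z0 ^+ 2 + z0 * z1 + z1 ^+ 2)).
  have := cnD (c2 * (z0 + z1)) (c3 * (z0 ^+ 2 + z0 * z1 + z1 ^+ 2)).
  by have := mulb _ _ _ _ h2 s1; have := mulb _ _ _ _ h3 s2; lra.
have h0 : cn c0 <= 60 * (1000 * e).
  have -> : c0 = c z0 - (c1 * z0 + (c2 * (z0 * z0) + c3 * (z0 * (z0 * z0)))).
    by rewrite /c /cubic; ring.
  have s2 := mulb _ _ _ _ b0 b0; have s3 := mulb _ _ _ _ b0 s2.
  have := cnB (c z0) (c1 * z0 + (c2 * (z0 * z0) + c3 * (z0 * (z0 * z0)))).
  have := cnD (c1 * z0) (c2 * (z0 * z0) + c3 * (z0 * (z0 * z0))).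
  have := cnD (c2 * (z0 * z0)) (c3 * (z0 * (z0 * z0))).
  by have := mulb _ _ _ _ h1 b0; have := mulb _ _ _ _ h2 s2;
     have := mulb _ _ _ _ h3 s3; lra.
by split; lra.
Qed.

(* Near scale 1 a rational map p/q close to z has p ~ z q, near scale d one close
   to 1 + d/z has z p ~ (z + d) q; no pair of quadratic polynomials satisfies both. *)
Lemma two_scale_contradiction (p0 p1 p2 q0 q1 q2 : R[i]) (d S S' : R) :
  0 < d -> d < 1 -> 0 < S ->
  S = cn p0 + cn p1 + cn p2 + cn q0 + cn q1 + cn q2 ->
  S' = cn p0 + d * cn p1 + d ^+ 2 * cn p2 + cn q0 + d * cn q1 + d ^+ 2 * cn q2 ->
  [/\ cn p0 <= S / 100, cn (q0 - p1) <= S / 100, cn (q1 - p2) <= S / 100 & cn q2 <= S / 100] ->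
  cn q0 <= S' / 100 ->
  cn (q0 + (d%:C)%C * q1 - p0) <= S' / 100 ->
  cn ((d%:C)%C * q1 + (d%:C)%C ^+ 2 * q2 - (d%:C)%C * p1) <= S' / 100 -> False.
Proof.
move=> d0 d1 S0 SE SE' [A0 A1 A2 A3] B0 B1 B2.
set D := (d%:C)%C in B1 B2.
have cD z : cn (D * z) = d * cn z by rewrite cnM cn_real ?ltW.
have cD2 z : cn (D ^+ 2 * z) = d ^+ 2 * cn z by rewrite cnM cnX cn_real ?ltW.
have a1 : cn p1 <= cn q0 + S / 100.
  have := cn_sub p1 q0; have -> : p1 - q0 = - (q0 - p1) by ring.
  by rewrite cnN; lra.
have a2 : cn p2 <= cn q1 + S / 100.
  have := cn_sub p2 q1; have -> : p2 - q1 = - (q1 - p2) by ring.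
  by rewrite cnN; lra.
have C1 : d * cn q1 <= d * cn p1 + d ^+ 2 * cn q2 + S' / 100.
  have := cn_sub (D * q1) (D * p1 - D ^+ 2 * q2).
  have -> : D * q1 - (D * p1 - D ^+ 2 * q2) = D * q1 + D ^+ 2 * q2 - D * p1 by ring.
  by have := cnB (D * p1) (D ^+ 2 * q2); rewrite !cD !cD2; lra.
have C0 : cn p0 <= cn q0 + d * cn q1 + S' / 100.
  have := cn_sub p0 (q0 + D * q1).
  have -> : p0 - (q0 + D * q1) = - (q0 + D * q1 - p0) by ring.
  by have := cnD q0 (D * q1); rewrite cnN cD; lra.
move: SE SE' A0 A3 B0 a1 a2 C0 C1.
have := cn_ge0 p0; have := cn_ge0 p1; have := cn_ge0 p2.
have := cn_ge0 q0; have := cn_ge0 q1; have := cn_ge0 q2.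
move: (cn p0) (cn p1) (cn p2) (cn q0) (cn q1) (cn q2) => x0 x1 x2 y0 y1 y2.
move=> Y2 Y1 Y0 X2 X1 X0 SE SE' A0 A3 B0 a1 a2 C0 C1.
have dp (x y : R) : x <= y -> d * x <= d * y by move=> ?; rewrite ler_wpM2l// ltW.
have dq (x : R) : 0 <= x -> d * x <= x by move=> ?; rewrite ler_piMl// ltW.
have dd (x : R) : d ^+ 2 * x = d * (d * x) by rewrite mulrA.
rewrite !dd in SE' C1.
have m0 := dp _ _ X0; have m1 := dp _ _ X1; have m2 := dp _ _ X2.
have n0 := dp _ _ Y0; have n1 := dp _ _ Y1; have n2 := dp _ _ Y2.
have SS : S' <= S.
  have := dq _ X1; have := dq _ Y1; have := dq _ X2; have := dq _ Y2.
  have := dp _ _ (dq _ X2); have := dp _ _ (dq _ Y2).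
  by move=> *; lra.
(* Outside, only q1 and p2 survive and p2 is close to q1, so |q1| is nearly S / 2. But [C1] bounds d
   |q1| by d |p1|, small through [a1] and [B0], plus small multiples of d S: this is the conflict of
   neck values. *)
have b1 : S <= 2 * y1 + 6 * (S / 100) by lra.
have db1 := dp _ _ b1; have dS : 0 < d * S by rewrite mulr_gt0.
have da1 := dp _ _ a1; have da2 := dp _ _ a2; have dA3 := dp _ _ A3.
have dB0 := dp _ _ B0; have dSS := dp _ _ SS.
have ddA3 := dp _ _ dA3; have dda2 := dp _ _ da2.
have ddS := dq _ (ltW dS); have y1S : y1 <= S by lra.
have dy1S := dp _ _ y1S.
have ddy1 : d * (d * y1) <= d * y1 by apply: dp; exact: dq.
have dC1 : d * (y0 + S / 100) = d * y0 + d * S / 100 by ring.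
lra.
Qed.

End ComplexNorm.

Arguments cn {R} z : simpl never.

(** * Rational maps *)

Section RationalMaps.
Context {R : realType}.
Implicit Types (p q : {poly R[i]}) (z : R * R).

Definition toC z : R[i] := Complex z.1 z.2.
Definition hre p z : R := complex.Re p.[toC z].
Definition him p z : R := complex.Im p.[toC z].

(** The Cauchy-Riemann equations, by induction along Horner's scheme. *)
Lemma hasgrad_horner p :
  hasgrad (hre p) (hre p^`()) (fun z => - him p^`() z) /\
  hasgrad (him p) (him p^`()) (hre p^`()).
Proof.
elim/poly_ind: p => [|p c [hr hi]].
  have E0 : hre 0 = fun=> 0 by apply/funext => z; rewrite /hre horner0.
  have E1 : him 0 = fun=> 0 by apply/funext => z; rewrite /him horner0.
  rewrite deriv0 E0 E1; split; last exact: hasgrad_cst.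
  by apply: hasgradE (hasgrad_cst 0) _ _ => z //; rewrite oppr0.
have mulE (u v : R[i]) : complex.Re (u * v) = complex.Re u * complex.Re v - complex.Im u * complex.Im v
    /\ complex.Im (u * v) = complex.Re u * complex.Im v + complex.Im u * complex.Re v.
  by case: u => a b; case: v.
have addE (u v : R[i]) : complex.Re (u + v) = complex.Re u + complex.Re v
    /\ complex.Im (u + v) = complex.Im u + complex.Im v.
  by case: u => a b; case: v.
have E0 : hre (p * 'X + c%:P) = fun z => hre p z * z.1 - him p z * z.2 + complex.Re c.
  by apply/funext => z; rewrite /hre !hornerE (addE _ _).1 (mulE _ _).1.
have E1 : him (p * 'X + c%:P) = fun z => hre p z * z.2 + him p z * z.1 + complex.Im c.
  by apply/funext => z; rewrite /him !hornerE (addE _ _).2 (mulE _ _).2.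
have D0 z : hre (p * 'X + c%:P)^`() z = hre p^`() z * z.1 - him p^`() z * z.2 + hre p z.
  by rewrite /hre derivMXaddC !hornerE (addE _ _).1 (mulE _ _).1 addrC.
have D1 z : him (p * 'X + c%:P)^`() z = hre p^`() z * z.2 + him p^`() z * z.1 + him p z.
  by rewrite /him derivMXaddC !hornerE (addE _ _).2 (mulE _ _).2 addrC.
have hx := @hasgrad_fst R; have hy := @hasgrad_snd R.
rewrite E0 E1; split.
- have := hasgradD (hasgradB (hasgradM hr hx) (hasgradM hi hy)) (hasgrad_cst (complex.Re c)).
  by move/hasgradE; apply => z; rewrite ?D0 ?D1; ring.
- have := hasgradD (hasgradD (hasgradM hr hy) (hasgradM hi hx)) (hasgrad_cst (complex.Im c)).
  by move/hasgradE; apply => z; rewrite ?D0 ?D1; ring.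
Qed.

(** A common zero would contradict a Bezout relation u p + v q = 1. *)
Lemma spin_coprime p q z : coprimep p q -> 0 < spin (hre p z) (him p z) (hre q z) (him q z).
Proof.
move=> cpq; have N0 (w : R[i]) : complex.Re w ^+ 2 + complex.Im w ^+ 2 = 0 -> w = 0.
  case: w => a b /= /eqP; rewrite paddr_eq0 ?sqr_ge0// !sqrf_eq0.
  by move=> /andP[/eqP-> /eqP->].
rewrite lt0r; apply/andP; split; last first.
  by rewrite /spin !addr_ge0// sqr_ge0.
apply/negP => /eqP; rewrite /spin -addrA => /eqP.
rewrite paddr_eq0 ?addr_ge0 ?sqr_ge0// => /andP[/eqP/N0 p0 /eqP/N0 q0].
have /Bezout_eq1_coprimepP [[u v] /= E] := cpq.
have := congr1 (fun r => r.[toC z]) E.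
rewrite !hornerE /= p0 q0 !mulr0 addr0 => /eqP.
by rewrite eq_sym oner_eq0.
Qed.

(** Homogeneous coordinates absorb the case distinction at the poles and make smoothness there
    visible. *)
Lemma stereo_rat_hopf p q z : coprimep p q ->
  stereo_rat p q z = hopf (hre p z) (him p z) (hre q z) (him q z).
Proof.
move=> /(spin_coprime z); rewrite /stereo_rat /hre /him -/(toC z).
case: eqP => [q0|/eqP q0].
  rewrite {}q0 /=; case: (p.[toC z]) => a b /=; rewrite /spin expr0n/= !addr0 => s0.
  rewrite /hopf /north_pole /row3 /spin; apply/rowP => i.
  rewrite !mxE; case: i => [[|[|[|//]]] hi] /=; field; lra.
move: (p.[toC z]) (q.[toC z]) q0 => [a b] [c e] q0 s0.
have n0 : 0 < c ^+ 2 + e ^+ 2.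
  rewrite lt0r addr_ge0 ?sqr_ge0// andbT paddr_eq0 ?sqr_ge0// !sqrf_eq0.
  by apply: contra q0 => /andP[/eqP-> /eqP->].
have -> : (Complex a b / Complex c e) =
   Complex ((a * c + b * e) / (c ^+ 2 + e ^+ 2)) ((b * c - a * e) / (c ^+ 2 + e ^+ 2)).
  apply: (mulIf q0); rewrite divfK//; apply/eqP; rewrite eq_complex /=.
  by apply/andP; split; apply/eqP; field; rewrite gt_eqF.
move: s0; rewrite /spin/= => s0.
rewrite /stereo /hopf /row3 /spin /normsqC /=; apply/rowP => i.
set X := (a * c + b * e); set Y := (b * c - a * e).
have XY : X ^+ 2 + Y ^+ 2 = (a ^+ 2 + b ^+ 2) * (c ^+ 2 + e ^+ 2) by rewrite /X /Y; ring.
set n := c ^+ 2 + e ^+ 2 in n0 XY *.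
have -> : (X / n) ^+ 2 + (Y / n) ^+ 2 = (a ^+ 2 + b ^+ 2) / n.
  transitivity ((X ^+ 2 + Y ^+ 2) / n ^+ 2); first by field; rewrite gt_eqF.
  by rewrite XY; field; rewrite gt_eqF.
have s1 : 0 < n + (a ^+ 2 + b ^+ 2) by rewrite /n; lra.
have -> : 1 + (a ^+ 2 + b ^+ 2) / n = (n + (a ^+ 2 + b ^+ 2)) / n.
  by field; rewrite gt_eqF.
have -> : a ^+ 2 + b ^+ 2 + c ^+ 2 + e ^+ 2 = n + (a ^+ 2 + b ^+ 2) by rewrite /n; ring.
have -> : a ^+ 2 + b ^+ 2 - c ^+ 2 - e ^+ 2 = a ^+ 2 + b ^+ 2 - n by rewrite /n; ring.
move: (a ^+ 2 + b ^+ 2) s1 => m s1.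
by rewrite !mxE; case: i => [[|[|[|//]]] hi] /=; field; rewrite !gt_eqF.
Qed.

Definition rwre p q z : R :=
  wre (hre p z) (him p z) (hre q z) (him q z) (hre p^`() z) (him p^`() z) (hre q^`() z) (him q^`() z).
Definition rwim p q z : R :=
  wim (hre p z) (him p z) (hre q z) (him q z) (hre p^`() z) (him p^`() z) (hre q^`() z) (him q^`() z).

Lemma hasgrad3_stereo_rat p q : coprimep p q -> hasgrad3 (stereo_rat p q)
  (fun z => hopfD (hre p z) (him p z) (hre q z) (him q z) (rwre p q z) (rwim p q z))
  (fun z => hopfD (hre p z) (him p z) (hre q z) (him q z) (- rwim p q z) (rwre p q z)).
Proof.
move=> cpq.
have [pr pi] := hasgrad_horner p; have [qr qi] := hasgrad_horner q.
have := hasgrad3_hopf (fun z => spin_coprime z cpq) pr pi qr qi.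
have -> : stereo_rat p q = fun z => hopf (hre p z) (him p z) (hre q z) (him q z).
  by apply/funext => z; exact: stereo_rat_hopf.
move=> H i; move: (H i); set f := fun z => _.
have -> // : (fun z => hopfD (hre p z) (him p z) (hre q z) (him q z)
    (wre (hre p z) (him p z) (hre q z) (him q z) (- him p^`() z) (hre p^`() z) (- him q^`() z) (hre q^`() z))
    (wim (hre p z) (him p z) (hre q z) (him q z) (- him p^`() z) (hre p^`() z) (- him q^`() z) (hre q^`() z)) ord0 i)
  = (fun z => hopfD (hre p z) (him p z) (hre q z) (him q z) (- rwim p q z) (rwre p q z) ord0 i).
apply/funext => z; congr (hopfD _ _ _ _ _ _ _ _).
- by rewrite /rwim /wre /wim; ring.
- by rewrite /rwre /wre /wim; ring.
Qed.

Context (L : R).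

Definition gap p q z : R := gradsq (fun w => bub L w - stereo_rat p q w) z.

Lemma contm_gap p q : coprimep p q -> contm (gap p q).
Proof.
move=> cpq; have h := hasgrad3B (hasgrad3_bub L) (hasgrad3_stereo_rat cpq).
have -> : gap p q = _ := funext (fun z => gradsq_hasgrad3 z h).
under eq_fun do rewrite sum3E.
have c i : contm (fun z => (hopfD (pre L z) (pim L z) z.1 z.2 (wxre L z) (wxim L z) -
   hopfD (hre p z) (him p z) (hre q z) (him q z) (rwre p q z) (rwim p q z)) ord0 i ^+ 2 +
   (hopfD (pre L z) (pim L z) z.1 z.2 (wyre L z) (wyim L z) -
   hopfD (hre p z) (him p z) (hre q z) (him q z) (- rwim p q z) (rwre p q z)) ord0 i ^+ 2).
  by have [_ _ _ [_ cx cy]] := h i; apply: contmD; exact: contmX.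
by apply: contmD => //; exact: contmD.
Qed.

(* Where phi is locally constant, bub is conformal. *)
Lemma gap_ge p q z : coprimep p q -> phm L z = 0 ->
  let w := toC z in let P := Complex (pre L z) (pim L z) in
  4 * cn (P * q.[w] - p.[w] * w) ^+ 2 * cn (w ^+ 2 - (dlt L)%:C%C) ^+ 2 <=
  gap p q z * (cn P ^+ 2 + cn w ^+ 2) ^+ 3 * (cn p.[w] ^+ 2 + cn q.[w] ^+ 2).
Proof.
move=> cpq m0 /=.
have h := hasgrad3B (hasgrad3_bub L) (hasgrad3_stereo_rat cpq).
(* Cauchy-Riemann for the bubble where grad phi vanishes: w_y = i w_x. *)
have E1 : wyre L z = - wxim L z.
  by rewrite /wyre /wxim /wre /wim /pre_y /pim_y /pre_x /pim_x m0; ring.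
have E2 : wyim L z = wxre L z.
  by rewrite /wyim /wxre /wre /wim /pre_y /pim_y /pre_x /pim_x m0; ring.
have := @hopf_conformal_gap R (pre L z) (pim L z) z.1 z.2 (hre p z) (him p z) (hre q z) (him q z)
  (wxre L z) (wxim L z) (rwre p q z) (rwim p q z) (gap p q z) (bspin_gt0 L z) (spin_coprime z cpq).
have -> : gap p q z = \sum_(i < 3)
  ((hopfD (pre L z) (pim L z) z.1 z.2 (wxre L z) (wxim L z) ord0 i -
    hopfD (hre p z) (him p z) (hre q z) (him q z) (rwre p q z) (rwim p q z) ord0 i) ^+ 2 +
   (hopfD (pre L z) (pim L z) z.1 z.2 (- wxim L z) (wxre L z) ord0 i -
    hopfD (hre p z) (him p z) (hre q z) (him q z) (- rwim p q z) (rwre p q z) ord0 i) ^+ 2).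
  rewrite [LHS](gradsq_hasgrad3 _ h) E1 E2.
  by apply: eq_bigr => i _; rewrite !mxE.
move=> /(_ erefl); move: (\sum_(i < 3) _) => g.
rewrite !cn_sqr /spin /hre /him -/(toC z).
(* Here the Wronskian is (2 z + phi) z - (z^2 + phi z + d) = z^2 - d. *)
have -> : wxre L z = z.1 ^+ 2 - z.2 ^+ 2 - dlt L.
  by rewrite /wxre /wre /pre_x /pim_x /pre /pim m0; ring.
have -> : wxim L z = 2 * z.1 * z.2.
  by rewrite /wxim /wim /pre_x /pim_x /pre /pim m0; ring.
case: (p.[toC z]) => a b; case: (q.[toC z]) => c e /=.
rewrite /toC; case: z {h m0 E1 E2} => x y /=; rewrite expr2 /=.
set A := pre L _; set B := pim L _ => H.
apply: le_trans (le_trans _ H) _;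
  by rewrite le_eqVlt; apply/orP; left; apply/eqP; ring.
Qed.

End RationalMaps.

(** * Distance to rational maps *)

Section Rigidity.
Local Open Scope classical_set_scope.
Context {R : realType}.

Local Notation mu := (@lebesgue_measure R).
Local Notation mu2 := (mu \x mu)%E.

Lemma rectangle_measure (a b c d : R) : a < b -> c < d ->
  mu2 (`[a, b] `*` `[c, d]) = ((b - a) * (d - c))%:E.
Proof.
have itvE u v : u < v -> mu `[u, v] = (v - u)%:E.
  by move=> uv; rewrite lebesgue_measure_itv/= lte_fin uv.
move=> ab cd; rewrite product_measure1E; [|exact: measurable_itv|exact: measurable_itv].
rewrite EFinM -(itvE _ _ ab) -(itvE _ _ cd); exact: erefl.
Qed.

(** Otherwise g exceeds e divided by the area on the whole rectangle, and its integral is at least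
    e. *)
Lemma good_point (g : R * R -> R) (a b c d e : R) : contm g -> (forall z, 0 <= g z) ->
  a < b -> c < d -> 0 <= e -> (\int[mu2]_z (g z)%:E < e%:E)%E ->
  exists s t, [/\ a <= s <= b, c <= t <= d & g (s, t) * ((b - a) * (d - c)) <= e].
Proof.
move=> [_ mg] g0 ab cd e0 ge; apply: contrapT => H.
have A0 : 0 < (b - a) * (d - c) by rewrite mulr_gt0// subr_gt0.
have mA : measurable (`[a, b] `*` `[c, d] : set (measurableTypeR R * measurableTypeR R)).
  by apply: measurableX; exact: measurable_itv.
have Hg z : (`[a, b] `*` `[c, d]) z -> e / ((b - a) * (d - c)) <= g z.
  case: z => s t [/=]; rewrite !in_itv/= => sab tcd.
  rewrite leNgt; apply/negP => gz; apply: H; exists s, t; split => //.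
  by rewrite -ler_pdivlMr// ltW.
have mgE : measurable_fun [set: measurableTypeR R * measurableTypeR R] (EFin \o g).
  exact/measurable_EFinP.
have : (\int[mu2]_(z in `[a, b] `*` `[c, d]) (e / ((b - a) * (d - c)))%:E <=
        \int[mu2]_z (g z)%:E)%E.
  apply: (@le_trans _ _ (\int[mu2]_(z in `[a, b] `*` `[c, d]) (g z)%:E)%E).
    apply: ge0_le_integral => //.
    - by move=> z _; rewrite lee_fin divr_ge0// ltW.
    - exact: measurable_funTS.
  by apply: ge0_subset_integral => // z _; rewrite lee_fin.
move=> /le_lt_trans => /(_ _ ge); apply/negP; rewrite -leNgt.
apply: (@le_trans _ _ ((e / ((b - a) * (d - c)))%:E * mu2 (`[a, b] `*` `[c, d]))%E).
  by rewrite rectangle_measure// -EFinM divfK ?gt_eqF.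
by rewrite -(integral_cst _ mA).
Qed.

Implicit Types (p q : {poly R[i]}) (x y : R[i]).

Lemma cn_ge_Re x : complex.Re x <= cn x.
Proof.
apply: le_trans (ler_norm _) _.
rewrite -(ler_sqr (x := `|_|)) ?nnegrE ?cn_ge0// cn_sqr real_normK ?num_real//.
by rewrite lerDl sqr_ge0.
Qed.

Lemma cn_ge_Im x : complex.Im x <= cn x.
Proof.
apply: le_trans (ler_norm _) _.
rewrite -(ler_sqr (x := `|_|)) ?nnegrE ?cn_ge0// cn_sqr real_normK ?num_real//.
by rewrite lerDr sqr_ge0.
Qed.

Lemma horner_quadratic p x : (size p <= 3)%N -> p.[x] = p`_0 + p`_1 * x + p`_2 * x ^+ 2.
Proof.
move=> sp; rewrite (horner_coef_wide _ sp) !big_ord_recl big_ord0 /=.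
by rewrite expr0 expr1 mulr1 addr0 addrA.
Qed.

Lemma quadratic_bound (a b c x : R[i]) (l : R) : 0 <= l -> cn x <= 8 ->
  cn (a + b * ((l%:C)%C * x) + c * ((l%:C)%C * x) ^+ 2) <=
  64 * (cn a + l * cn b + l ^+ 2 * cn c).
Proof.
move=> l0 x8; have := cn_ge0 a; have := cn_ge0 b; have := cn_ge0 c; have x0 := cn_ge0 x.
have := cnD (a + b * ((l%:C)%C * x)) (c * ((l%:C)%C * x) ^+ 2).
have := cnD a (b * ((l%:C)%C * x)).
rewrite (cnM c) cnX !cnM cn_real//.
move: (cn a) (cn b) (cn c) (cn x) x8 x0 => u v w r r8 r0 h1 h2 w0 v0 u0.
have r64 : r ^+ 2 <= 64 by nra.
have lv : 0 <= l * v by rewrite mulr_ge0.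
have lw : 0 <= l ^+ 2 * w by rewrite mulr_ge0 ?sqr_ge0.
have e1 : v * (l * r) <= 8 * (l * v).
  by rewrite (_ : v * (l * r) = r * (l * v)); [rewrite ler_wpM2r|ring].
have e2 : w * (l * r) ^+ 2 <= 64 * (l ^+ 2 * w).
  by rewrite (_ : w * (l * r) ^+ 2 = r ^+ 2 * (l ^+ 2 * w)); [rewrite ler_wpM2r|ring].
lra.
Qed.

(** [gap_ge] at z = l zeta with the powers of l removed: the gap scales like l^-2, while the bubble
    has numerator l a, denominator l zeta and Wronskian l omega. *)
Lemma scale_estimate (L : R) p q (z : R * R) (l e kappa S : R) (zeta a omega : R[i]) :
  coprimep p q -> phm L z = 0 -> 0 < l ->
  toC z = (l%:C)%C * zeta -> Complex (pre L z) (pim L z) = (l%:C)%C * a ->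
  toC z ^+ 2 - (dlt L)%:C%C = (l%:C)%C * omega ->
  cn zeta <= 8 -> cn a <= 80 -> 1 <= 2 * cn omega ->
  0 <= kappa -> e * (10 ^+ 12 * 10 ^+ 5) <= kappa ^+ 2 -> gap L p q z * l ^+ 2 <= e ->
  0 <= S -> cn p.[toC z] <= 64 * S -> cn q.[toC z] <= 64 * S ->
  cn (a * q.[toC z] - zeta * p.[toC z]) <= kappa * S.
Proof.
move=> cpq m0 l0 zE aE oE z8 a80 o1 k0 ke ge S0 pS qS.
have := gap_ge cpq m0; rewrite /= oE aE.
have -> : (l%:C)%C * a * q.[toC z] - p.[toC z] * toC z =
  (l%:C)%C * (a * q.[toC z] - zeta * p.[toC z]).
  by rewrite mulrBr !mulrA -zE [p.[_] * _]mulrC.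
have -> : cn (toC z) = l * cn zeta by rewrite zE cnM cn_real// ltW.
rewrite !cnM !cn_real ?(ltW l0)//.
set X := cn (_ - _); set P := cn p.[_] in pS *; set Q := cn q.[_] in qS *.
have G0 : 0 <= gap L p q z by exact: gradsq_ge0.
have P0 : 0 <= P by exact: cn_ge0.
have Q0 : 0 <= Q by exact: cn_ge0.
have X0 : 0 <= X by exact: cn_ge0.
have := cn_ge0 zeta; have := cn_ge0 a; have := cn_ge0 omega.
move: (cn zeta) (cn a) (cn omega) (gap L p q z) z8 a80 o1 ge G0 => r s o G.
move=> r8 s80 o1 ge G0 o0 s0 r0 H.
(* 80^2 + 8^2 <= 10^4, and in [PQ] below 2 * 64^2 <= 10^5; hence the factor 10^12 * 10^5. *)
have n1 : s ^+ 2 + r ^+ 2 <= 10 ^+ 4 by nra.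
have n3 : (s ^+ 2 + r ^+ 2) ^+ 3 <= 10 ^+ 12.
  have -> : 10 ^+ 12 = (10 ^+ 4) ^+ 3 :> R by rewrite -exprM.
  by rewrite lerXn2r ?nnegrE ?addr_ge0 ?sqr_ge0 ?exprn_ge0.
have PQ : P ^+ 2 + Q ^+ 2 <= 10 ^+ 5 * S ^+ 2.
  have p2 : P ^+ 2 <= (64 * S) ^+ 2 by rewrite lerXn2r ?nnegrE ?mulr_ge0.
  have q2 : Q ^+ 2 <= (64 * S) ^+ 2 by rewrite lerXn2r ?nnegrE ?mulr_ge0.
  by have := sqr_ge0 S; rewrite !exprMn in p2 q2; lra.
have o2 : 1 <= 4 * o ^+ 2 by nra.
have l4 : 0 < l ^+ 4 by rewrite exprn_gt0.
rewrite -(ler_sqr (x := X)) ?nnegrE ?mulr_ge0//.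
rewrite -(ler_pM2l l4).
apply: (@le_trans _ _ (4 * (l * X) ^+ 2 * (l * o) ^+ 2)).
  have -> : 4 * (l * X) ^+ 2 * (l * o) ^+ 2 = (l ^+ 4 * X ^+ 2) * (4 * o ^+ 2) by ring.
  by rewrite ler_peMr// mulr_ge0 ?sqr_ge0// ltW.
apply: le_trans H _.
have -> : G * ((l * s) ^+ 2 + (l * r) ^+ 2) ^+ 3 * (P ^+ 2 + Q ^+ 2) =
  l ^+ 4 * ((G * l ^+ 2) * ((s ^+ 2 + r ^+ 2) ^+ 3 * (P ^+ 2 + Q ^+ 2))) by ring.
rewrite ler_wpM2l ?(ltW l4)//.
have -> : (kappa * S) ^+ 2 = kappa ^+ 2 * S ^+ 2 by rewrite exprMn.
apply: (@le_trans _ _ (e * (10 ^+ 12 * 10 ^+ 5) * S ^+ 2)); last first.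
  by rewrite ler_wpM2r ?sqr_ge0.
rewrite -[leRHS]mulrA; apply: ler_pM => //.
- by rewrite mulr_ge0// sqr_ge0.
- by apply: mulr_ge0; [apply: exprn_ge0|]; rewrite addr_ge0 ?sqr_ge0.
- by rewrite -[leRHS]mulrA; apply: ler_pM => //; [apply: exprn_ge0|]; rewrite addr_ge0 ?sqr_ge0.
Qed.

End Rigidity.

(** * Coefficients of a close rational map at the two scales *)

Section TwoScales.
Context {R : realType}.

Local Notation mu := (@lebesgue_measure R).
Local Notation mu2 := (mu \x mu)%E.

(** The four points lie in squares of side l with real part in [l, 2 l] and imaginary part starting
    at 0, 2 l, 4 l, 6 l: after rescaling they are 1 apart and of modulus at most sqrt(4 + 49) <=
    8. *)
Lemma four_point_bound (g : R * R -> R) (l e eps : R) (c0 c1 c2 c3 : R[i]) :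
  contm g -> (forall z, 0 <= g z) -> 0 < l -> 0 <= e -> (\int[mu2]_z (g z)%:E < e%:E)%E ->
  (forall zeta : R[i], 1 <= complex.Re zeta -> cn zeta <= 8 ->
     g (l * complex.Re zeta, l * complex.Im zeta) * l ^+ 2 <= e ->
     cn (cubic (c0, c1, c2, c3) zeta) <= eps) ->
  [/\ cn c0 <= 100 * (1000 * eps), cn c1 <= 100 * (1000 * eps),
      cn c2 <= 100 * (1000 * eps) & cn c3 <= 100 * (1000 * eps)].
Proof.
move=> cg g0 l0 e0 ge H.
have pt (k : R) : 0 <= k <= 6 -> exists zeta : R[i], [/\ cn zeta <= 8,
    k <= complex.Im zeta <= k + 1 & cn (cubic (c0, c1, c2, c3) zeta) <= eps].
  move=> k6; have [||s [t [/andP[s1 s2] /andP[t1 t2] gst]]] :=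
    @good_point R g l (2 * l) (k * l) ((k + 1) * l) e cg g0 _ _ e0 ge.
  - by lra.
  - by rewrite ltr_pM2r//; lra.
  have sE : l * (s / l) = s by rewrite mulrC divfK// gt_eqF.
  have tE : l * (t / l) = t by rewrite mulrC divfK// gt_eqF.
  have s1' : 1 <= s / l by rewrite ler_pdivlMr// mul1r.
  have s2' : s / l <= 2 by rewrite ler_pdivrMr.
  have t1' : k <= t / l by rewrite ler_pdivlMr.
  have t2' : t / l <= k + 1 by rewrite ler_pdivrMr.
  have z8 : cn (Complex (s / l) (t / l)) <= 8.
    rewrite -ler_sqr ?nnegrE ?cn_ge0// cn_sqr /=.
    by move: (s / l) (t / l) s1' s2' t1' t2' => a b *; nra.
  exists (Complex (s / l) (t / l)); split => //=; first by rewrite t1' t2'.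
  apply: H => //=; rewrite sE tE; move: gst.
  by rewrite (_ : (2 * l - l) * ((k + 1) * l - k * l) = l ^+ 2)//; ring.
have [|z0 [b0 /andP[i0 j0] e_0]] := pt 0; first by apply/andP; split; lra.
have [|z1 [b1 /andP[i1 j1] e_1]] := pt 2; first by apply/andP; split; lra.
have [|z2 [b2 /andP[i2 j2] e_2]] := pt 4; first by apply/andP; split; lra.
have [|z3 [b3 /andP[i3 j3] e_3]] := pt 6; first by apply/andP; split; lra.
have sep (z w : R[i]) : complex.Im z + 1 <= complex.Im w -> 1 <= cn (w - z).
  move=> h; apply: le_trans (cn_ge_Im _); move: h.
  by case: z => a b; case: w => a' b' /=; lra.
by apply: (@cubic_coef_bound R c0 c1 c2 c3 z0 z1 z2 z3 eps); split => //; apply: sep; lra.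
Qed.

Context (L : R) (L1 : 1 <= L).
Context (p q : {poly R[i]}) (cpq : coprimep p q) (sp : (size p <= 3)%N) (sq : (size q <= 3)%N).
Context (kappa e : R) (k0 : 0 <= kappa) (e0 : 0 <= e).
Context (ek : e * (10 ^+ 12 * 10 ^+ 5) <= kappa ^+ 2).
Context (kb : kappa * (100 * 1000) * 200 <= 1).
Context (db : dlt L * (4096 * (100 * 1000)) * 200 <= 1).
Context (gapb : (\int[mu2]_z (gap L p q z)%:E < e%:E)%E).

(** The coefficient norm of the rescaled pair p(l x), q(l x), against which errors are measured. *)
Let S (l : R) : R := cn p`_0 + l * cn p`_1 + l ^+ 2 * cn p`_2 +
                     cn q`_0 + l * cn q`_1 + l ^+ 2 * cn q`_2.

Lemma scale_sum_bound (l : R) (x : R[i]) : 0 < l -> cn x <= 8 ->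
  [/\ 0 <= S l, cn p.[(l%:C)%C * x] <= 64 * S l & cn q.[(l%:C)%C * x] <= 64 * S l].
Proof.
move=> l0 x8; rewrite (horner_quadratic _ sp) (horner_quadratic _ sq).
have := quadratic_bound p`_0 p`_1 p`_2 (ltW l0) x8.
have := quadratic_bound q`_0 q`_1 q`_2 (ltW l0) x8.
have n (u : R[i]) : 0 <= l * cn u by rewrite mulr_ge0 ?cn_ge0// ltW.
have m (u : R[i]) : 0 <= l ^+ 2 * cn u by rewrite mulr_ge0 ?cn_ge0// sqr_ge0.
have := cn_ge0 p`_0; have := cn_ge0 q`_0.
have := n p`_1; have := n q`_1; have := m p`_2; have := m q`_2.
by rewrite /S => *; split; lra.
Qed.

(** The second term pays for replacing the bubble by its limit profile: at the inner scale the
    dropped d x^2 q is at most d * 64 * 64 [S]. *)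
Let eps (l : R) := (kappa + 4096 * dlt L) * S l.

(** [kb] and [db] each contribute 1/200. *)
Lemma eps_small (l : R) : 0 <= S l -> 100 * (1000 * eps l) <= S l / 100.
Proof.
move=> S0; rewrite /eps.
have -> : 100 * (1000 * ((kappa + 4096 * dlt L) * S l)) =
  (kappa * (100 * 1000) + dlt L * (4096 * (100 * 1000))) * S l by ring.
rewrite [leRHS]mulrC ler_wpM2r//; move: kb db; lra.
Qed.

Lemma dlt_tiny : dlt L <= 1000^-1.
Proof. by have := dlt_gt0 L; have := db; lra. Qed.

Lemma dlt_real_cn : cn ((dlt L)%:C)%C = dlt L.
Proof. by rewrite cn_real// ltW// dlt_gt0. Qed.

Lemma toC_scale (l : R) (x : R[i]) :
  toC (l * complex.Re x, l * complex.Im x) = (l%:C)%C * x.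
Proof.
case: x => a b; rewrite /toC /=; apply/eqP; rewrite eq_complex /=.
by apply/andP; split; apply/eqP; ring.
Qed.

Lemma cn_ge1 (x : R[i]) : 1 <= complex.Re x -> 1 <= cn x.
Proof. by move=> h; apply: le_trans h (cn_ge_Re x). Qed.

(** The bubble is (x^2 + d) / x there; up to d it is x, so the cubic x q - p is small and has these
    coefficients up to sign. *)
Lemma outer_coefs : [/\ cn p`_0 <= S 1 / 100, cn (q`_0 - p`_1) <= S 1 / 100,
  cn (q`_1 - p`_2) <= S 1 / 100 & cn q`_2 <= S 1 / 100].
Proof.
have d0 := dlt_gt0 L; have dt := dlt_tiny.
have S1 : 0 <= S 1 by have [] := @scale_sum_bound 1 0 ltr01 _; rewrite ?cn0.
have H := @four_point_bound (gap L p q) 1 e (eps 1) (- p`_0) (q`_0 - p`_1)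
  (q`_1 - p`_2) q`_2 (contm_gap L cpq) (fun z => gradsq_ge0 _ z) ltr01 e0 gapb.
have {H} [] := H.
  move=> x x1 x8; set z := (_, _) => gz.
  have xz : toC z = (1%:C)%C * x by exact: toC_scale.
  have xz1 : toC z = x by rewrite xz mul1r.
  have n1 := cn_ge1 x1.
  have [] := @phi_outer _ _ L1 z.
    rewrite /Sd /rsq /z /= !mul1r; have := sqr_ge0 (complex.Im x).
    by have := sqr_ge0 (dlt L); nra.
  move=> ph0 pm0.
  have [_ pS qS] := scale_sum_bound ltr01 x8; rewrite mul1r in pS qS.
  have P0 : Complex (pre L z) (pim L z) = (1%:C)%C * (x ^+ 2 + ((dlt L)%:C)%C).
    rewrite mul1r /pre /pim ph0 /z /= !mul1r; case: x {x1 x8 z gz xz xz1 n1 ph0 pm0 pS qS} => a b.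
    by apply/eqP; rewrite eq_complex /=; apply/andP; split; apply/eqP; rewrite ?expr2; ring.
  have W0 : toC z ^+ 2 - ((dlt L)%:C)%C = (1%:C)%C * (x ^+ 2 - ((dlt L)%:C)%C).
    by rewrite xz1 mul1r.
  have a80 : cn (x ^+ 2 + ((dlt L)%:C)%C) <= 80.
    have := cnD (x ^+ 2) ((dlt L)%:C)%C; rewrite cnX dlt_real_cn.
    by have := cn_ge0 x; nra.
  have o1 : 1 <= 2 * cn (x ^+ 2 - ((dlt L)%:C)%C).
    have := cn_sub (x ^+ 2) ((dlt L)%:C)%C; rewrite cnX dlt_real_cn.
    by nra.
  have := scale_estimate cpq pm0 ltr01 xz P0 W0 x8 a80 o1 k0 ek gz S1.
  rewrite xz1 => /(_ pS qS) E.
  (* The estimate controls x (x q - p) + d q; the factor x can then be dropped because |x| >= 1. *)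
  have F : cn (x * (x * q.[x] - p.[x])) <= kappa * S 1 + dlt L * (64 * S 1).
    have -> : x * (x * q.[x] - p.[x]) =
      ((x ^+ 2 + ((dlt L)%:C)%C) * q.[x] - x * p.[x]) - ((dlt L)%:C)%C * q.[x] by ring.
    apply: le_trans (cnB _ _) _; apply: lerD => //.
    by rewrite cnM dlt_real_cn ler_wpM2l// ltW.
  have -> : cubic (- p`_0, q`_0 - p`_1, q`_1 - p`_2, q`_2) x = x * q.[x] - p.[x].
    by rewrite (horner_quadratic _ sp) (horner_quadratic _ sq) /cubic; ring.
  apply: (@le_trans _ _ (cn (x * (x * q.[x] - p.[x])))).
    by rewrite cnM ler_peMl ?cn_ge0.
  apply: le_trans F _; rewrite /eps.
  have : 0 <= dlt L * S 1 by rewrite mulr_ge0// ltW.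
  by lra.
rewrite cnN; have := eps_small S1 => es.
by split; apply: le_trans es.
Qed.

(** At z = d x the bubble is (d x^2 + x + 1) / x; without d x^2 the relevant cubic is (x + 1) q(d x)
    - x p(d x), and these are its three lowest coefficients. *)
Lemma inner_coefs (D := ((dlt L)%:C)%C) : [/\ cn q`_0 <= S (dlt L) / 100,
  cn (q`_0 + D * q`_1 - p`_0) <= S (dlt L) / 100 &
  cn (D * q`_1 + D ^+ 2 * q`_2 - D * p`_1) <= S (dlt L) / 100].
Proof.
have d0 := dlt_gt0 L; have dt := dlt_tiny.
have S1 : 0 <= S (dlt L) by have [] := @scale_sum_bound (dlt L) 0 d0 _; rewrite ?cn0.
have H := @four_point_bound (gap L p q) (dlt L) e (eps (dlt L)) (q`_0) (q`_0 + D * q`_1 - p`_0)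
  (D * q`_1 + D ^+ 2 * q`_2 - D * p`_1) (D ^+ 2 * q`_2 - D ^+ 2 * p`_2)
  (contm_gap L cpq) (fun z => gradsq_ge0 _ z) d0 e0 gapb.
have {H} [] := H.
  move=> x x1 x8; set z := (_, _) => gz.
  have xz : toC z = D * x by exact: toC_scale.
  have n1 := cn_ge1 x1.
  have [] := @phi_inner _ _ L1 z.
    (* As |x| <= 8, [Sd] is at most 65 d^2, below d because d <= 1/1000. *)
    have x2 : complex.Re x ^+ 2 + complex.Im x ^+ 2 <= 64.
      by rewrite -cn_sqr; have := cn_ge0 x; nra.
    rewrite /Sd /rsq /z /=.
    have -> : (dlt L * complex.Re x) ^+ 2 + (dlt L * complex.Im x) ^+ 2 + dlt L ^+ 2 =
      dlt L * (dlt L * (complex.Re x ^+ 2 + complex.Im x ^+ 2 + 1)) by ring.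
    rewrite ler_piMr ?(ltW d0)//; nra.
  move=> ph1 pm0.
  have [_ pS qS] := scale_sum_bound d0 x8.
  have P0 : Complex (pre L z) (pim L z) = D * (D * x ^+ 2 + x + 1).
    rewrite /pre /pim ph1 /z /= /D; case: x {x1 x8 z gz xz n1 ph1 pm0 pS qS} => a b.
    by apply/eqP; rewrite eq_complex /=; apply/andP; split; apply/eqP; rewrite ?expr2 /=; ring.
  have W0 : toC z ^+ 2 - D = D * (D * x ^+ 2 - 1) by rewrite xz; ring.
  have cD : cn D = dlt L := dlt_real_cn.
  have n2 : cn (D * x ^+ 2) <= 64 * dlt L.
    by rewrite cnM cnX cD mulrC ler_wpM2r ?(ltW d0)//; have := cn_ge0 x; nra.
  have a80 : cn (D * x ^+ 2 + x + 1) <= 80.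
    have := cnD (D * x ^+ 2 + x) 1; have := cnD (D * x ^+ 2) x; rewrite cn1.
    by lra.
  have o1 : 1 <= 2 * cn (D * x ^+ 2 - 1).
    have := cn_sub 1 (D * x ^+ 2).
    have -> : 1 - D * x ^+ 2 = - (D * x ^+ 2 - 1) by ring.
    by rewrite cnN cn1; lra.
  have := scale_estimate cpq pm0 d0 xz P0 W0 x8 a80 o1 k0 ek gz S1.
  rewrite xz => /(_ pS qS) E.
  have -> : cubic (q`_0, q`_0 + D * q`_1 - p`_0, D * q`_1 + D ^+ 2 * q`_2 - D * p`_1,
     D ^+ 2 * q`_2 - D ^+ 2 * p`_2) x =
     ((D * x ^+ 2 + x + 1) * q.[D * x] - x * p.[D * x]) - D * x ^+ 2 * q.[D * x].
    by rewrite (horner_quadratic _ sp) (horner_quadratic _ sq) /cubic; ring.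
  have -> : eps (dlt L) = kappa * S (dlt L) + 4096 * dlt L * S (dlt L) by rewrite /eps mulrDl.
  apply: le_trans (cnB _ _) _; apply: lerD => //.
  rewrite cnM; apply: (@le_trans _ _ ((64 * dlt L) * (64 * S (dlt L)))).
    by apply: ler_pM => //; exact: cn_ge0.
  by rewrite le_eqVlt; apply/orP; left; apply/eqP; ring.
have := eps_small S1 => es.
by move=> *; split; apply: le_trans es.
Qed.

Lemma no_close_rational : maxn (size p) (size q) = 3%N -> False.
Proof.
move=> spq; have [A0 A1 A2 A3] := outer_coefs; have [B0 B1 B2] := inner_coefs.
have d0 := dlt_gt0 L; have dt := dlt_tiny.
have cge := @cn_ge0 R.
(* Degree exactly 2 gives a nonzero coefficient of z^2 in p or q. *)
have S0 : 0 < S 1.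
  have lc (r : {poly R[i]}) : size r = 3%N -> 0 < cn r`_2.
    move=> sr; apply: cn_gt0.
    have -> : r`_2 = lead_coef r by rewrite lead_coefE sr.
    by rewrite lead_coef_eq0 -size_poly_eq0 sr.
  rewrite /S expr1n !mul1r.
  have := cge p`_0; have := cge p`_1; have := cge p`_2.
  have := cge q`_0; have := cge q`_1; have := cge q`_2.
  have [sq3|sp3] : size q = 3%N \/ size p = 3%N.
    by move: spq; rewrite /maxn; case: ifP => _ h; [left|right].
  - by have := lc _ sq3; lra.
  - by have := lc _ sp3; lra.
apply: (two_scale_contradiction d0 _ S0 _ erefl _ B0 B1 B2) => //; first by lra.
by rewrite /S expr1n !mul1r.
Qed.

End TwoScales.

(** * Choice of the constants and conclusion *)

Unset Implicit Arguments.

Theorem theorem1p5 (R : realType) (M : R) (hM : 0 < M) :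
  exists u : R * R -> 'rV[R]_3,
    [/\ sphere_valued u,
        (forall z, differentiable u z),
        finite_dirichlet u,
        degree u = 2
      & forall p q : {poly R[i]}, A2 p q ->
          ((M * (energy u - 8 * pi))%:E <
             \int[leb2 R]_z (gradsq (fun w => u w - stereo_rat p q w) z)%:E)%E].
Proof.
(* [kappa], [e] and [N] are absolute; only L depends on M. *)
have [kappa k0 kb] : exists2 k : R, 0 < k & k * (100 * 1000) * 200 <= 1.
  by exists (100 * 1000 * 200)^-1; lra.
have [e e0 ek] : exists2 e : R, 0 < e & e * (10 ^+ 12 * 10 ^+ 5) <= kappa ^+ 2.
  have t0 : 0 < 10 ^+ 12 * 10 ^+ 5 :> R by apply: mulr_gt0; apply: exprn_gt0.
  move: (10 ^+ 12 * 10 ^+ 5) t0 => T t0.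
  by exists (kappa ^+ 2 / T); rewrite ?divfK ?gt_eqF// divr_gt0// exprn_gt0.
have [N N1 N2] : exists2 N : R, 1 <= N & 4096 * (100 * 1000) * 200 <= N.
  by exists (4096 * (100 * 1000) * 200); lra.
(* L >= [N] makes [dlt] small enough for [db]; the other condition makes M times the excess at most
   12960 M / L < e. *)
have [L LN LM] : exists2 L : R, N <= L & M * 12960 / e < L.
  move: (M * 12960 / e) => c; exists (N + `|c| + 1).
    by have := normr_ge0 c; lra.
  by have := ler_norm c; lra.
have L1 : 1 <= L := le_trans N1 LN.
have L0 : 0 < L := lt_le_trans ltr01 L1.
have Le : M * 12960 / L < e.
  by rewrite ltr_pdivrMr// [ltRHS]mulrC -ltr_pdivrMr.
have [D hD bD] := defect_sq_le L1.
have [fin en deg] := bub_energy_degree L1 hD.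
exists (bub L); split => //.
- by move=> z; exact: hopf_unit (bspin_gt0 L z).
- by move=> z; exact: hasgrad3_differentiable (hasgrad3_bub L).
(* A rational map violating the inequality would have a gap of integral below e, against
   [no_close_rational]. *)
move=> p q [cpq spq]; rewrite ltNge; apply/negP => le_gap.
have MD : M * (energy (bub L) - 8 * pi) < e.
  rewrite en [8 * pi + D]addrC addrK; apply: le_lt_trans Le.
  by rewrite -mulrA ler_wpM2l// ltW.
have gapb := le_lt_trans le_gap (etrans (lte_fin _ _) MD).
have sp : (size p <= 3)%N by rewrite -spq leq_maxl.
have sq : (size q <= 3)%N by rewrite -spq leq_maxr.
have db : dlt L * (4096 * (100 * 1000)) * 200 <= 1.
  apply: le_trans (dlt_le L); rewrite -mulrA ler_wpM2l ?(ltW (dlt_gt0 L))//.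
  by apply: le_trans N2 (le_trans LN _); rewrite lerDr.
by have := no_close_rational L1 cpq sp sq (ltW k0) (ltW e0) ek kb db gapb spq.
Qed.
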